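(* Suppose that $(\mathcal{V},\mathcal{C},e)$ is an operator system and $p_1,\dots,p_N\in\mathcal{V}$ are positive contractions. The following are equivalent: (1) Each of $p_1,\dots,p_N$ is an abstract projection in $\mathcal{V}$. (2) For each $1\le i\le N$ the map $\pi_{p_i}:\mathcal{V}\to M_2(\mathcal{V})/\mathcal{J}_i$, $\pi_{p_i}(x)=x\otimes J_2+\mathcal{J}_i$, where $\mathcal{J}_i=\operatorname{span}\big(\mathcal{C}(p_i)_1\cap-\mathcal{C}(p_i)_1\big)$, is a complete order embedding into the operator system $(M_2(\mathcal{V})/\mathcal{J}_i,\{\mathcal{C}(p_i)_n+M_n(\mathcal{J}_i)\}_n,I_2\otimes e+\mathcal{J}_i)$. (3) The map $x\mapsto x\otimes J_{2^N}+\mathcal{J}$, where $\mathcal{J}=\operatorname{span}\big(\mathcal{C}(p_1,\dots,p_N)_1\cap-\mathcal{C}(p_1,\dots,p_N)_1\big)$, is a complete order embedding from $\mathcal{V}$ to the operator system $(M_{2^N}(\mathcal{V})/\mathcal{J},\{\mathcal{C}(p_1,\dots,p_N)_n+M_n(\mathcal{J})\}_n,e\otimes I_{2^N}+\mathcal{J})$.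
   Context: A matrix ordering on a (complex) $*$-vector space $\mathcal{V}$ is a sequence $\mathcal{C}=\{\mathcal{C}_n\}$ of cones $\mathcal{C}_n\subseteq M_n(\mathcal{V})_h$ (hermitian matrices; closed under addition and nonnegative scalars) with $\alpha\mathcal{C}_n\alpha^*\subseteq\mathcal{C}_m$ for every complex $m\times n$ matrix $\alpha$; it is proper if every $\mathcal{C}_n\cap-\mathcal{C}_n=\{0\}$. An operator system is $(\mathcal{V},\mathcal{C},e)$ with $\mathcal{C}$ a proper matrix ordering and, for each $n$, $I_n\otimes e$ an Archimedean order unit for $(M_n(\mathcal{V}),\mathcal{C}_n)$. A positive contraction is $p$ with $p,e-p\in\mathcal{C}_1$; $p^\perp=e-p$. A complete order embedding is a linear map that is a complete order isomorphism onto its range (it is injective, completely positive, with completely positive inverse on its range). A positive contraction $p\in\mathcal{V}$ is an abstract projection if there exist a Hilbert space $H$ and a unital complete order embedding $\pi:\mathcal{V}\to B(H)$ with $\pi(p)$ a projection; by an earlier known theorem this is equivalent to $p$ being a projection in the C*-envelope $C_e^*(\mathcal{V})$, and to $\pi_p$ being a complete order embedding. $I_m$ is the identity and $J_m$ the $m\times m$ all-ones matrix; $\otimes$ is the Kronecker product. For positive contractions $p_1,\dots,p_N$, put $P_k^N=I_{2^{k-1}}\otimes(p_k\oplus p_k^\perp)\otimes J_{2^{N-k}}$ and $Q_k^N=I_{2^{k-1}}\otimes(p_k^\perp\oplus p_k)\otimes J_{2^{N-k}}$ in $M_{2^N}(\mathcal{V})$. Then $\mathcal{C}(p_1,\dots,p_N)_n$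 is the set of $x=x^*\in M_{n2^N}(\mathcal{V})$ such that for all $\epsilon_1,\dots,\epsilon_N>0$ there exist $t_1,\dots,t_N>0$ with $$x+\sum_k\epsilon_kI_n\otimes P_k^N+\sum_kt_kI_n\otimes Q_k^N\in\mathcal{C}_{n2^N},$$ with the property that if one replaces $\epsilon_i$ with $\epsilon_i'<\epsilon_i$ then there exists $t_i'>t_i$ such that this membership still holds. For $N=1$, $\mathcal{C}(p)_n$ is the set of $x=x^*\in M_{2n}(\mathcal{V})$ such that for every $\epsilon>0$ there is $t>0$ with $x+\epsilon I_n\otimes(p\oplus p^\perp)+tI_n\otimes(p^\perp\oplus p)\in\mathcal{C}_{2n}$. One identifies $M_n(M_{2^N}(\mathcal{V})/\mathcal{J})$ with $M_{n2^N}(\mathcal{V})/M_n(\mathcal{J})$. *)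

(* Defs.v *)
From HB Require Import structures.
From mathcomp Require Import all_boot all_order all_algebra.
From mathcomp Require Import generic_quotient ring_quotient sesquilinear.
From mathcomp Require Import boolp classical_sets functions reals.
From mathcomp Require Import complex mxtens.

Set Implicit Arguments.
Unset Strict Implicit.
Unset Printing Implicit Defensive.

Import Order.TTheory GRing.Theory Num.Theory.

Local Open Scope classical_set_scope.
Local Open Scope ring_scope.
Local Open Scope complex_scope.
Local Open Scope quotient_scope.

Section StarMatrices.
Context {R : realType} {V : lmodType R[i]}.
Implicit Types (star : V -> V) (C : forall n, set 'M[V]_n).

Record is_star star : Prop := {
  starD : forall x y, star (x + y) = star x + star y ;
  starZ : forall (a : R[i]) x, star (a *: x) = Num.conj a *: star x ;
  starK : involutive star }.

Definition mxstar star m n (x : 'M[V]_(m, n)) : 'M[V]_(n, m) :=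
  map_mx star x^T.

(* MathComp has no scaling of 'M[V] by the scalars of V when V is not a ring *)
Definition mxscale m n (a : R[i]) (x : 'M[V]_(m, n)) : 'M[V]_(m, n) :=
  map_mx ( *:%R a) x.

(* alpha x alpha^* *)
Definition mxcompress m n (a : 'M[R[i]]_(m, n)) (x : 'M[V]_n) : 'M[V]_m :=
  \matrix_(i, j) \sum_k \sum_l (a i k * Num.conj (a j l)) *: x k l.

(* The level n = 0 is allowed; there everything is forced to be {0}. *)
Record matrix_ordering star C : Prop := {
  mo_herm : forall n x, C n x -> mxstar star x = x ;
  mo0 : forall n, C n 0 ;
  moD : forall n x y, C n x -> C n y -> C n (x + y) ;
  moZ : forall n (r : R) x, 0 <= r -> C n x -> C n (mxscale r%:C x) ;
  mo_compress : forall m n (a : 'M[R[i]]_(m, n)) x,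
    C n x -> C m (mxcompress a x) }.

Definition proper_cones C : Prop :=
  forall n x, C n x -> C n (- x) -> x = 0.

(* e%:M is I_n (x) e. *)
Definition matrix_order_unit star C (e : V) : Prop :=
  forall n (x : 'M[V]_n), mxstar star x = x ->
    exists2 r : R, 0 < r & C n (mxscale r%:C e%:M - x).

Definition matrix_archimedean C (e : V) : Prop :=
  forall n (x : 'M[V]_n),
    (forall r : R, 0 < r -> C n (mxscale r%:C e%:M + x)) -> C n x.

Record operator_system star C (e : V) : Prop := {
  os_star : is_star star ;
  os_ordering : matrix_ordering star C ;
  os_proper : proper_cones C ;
  os_unit_herm : star e = e ;
  os_unit : matrix_order_unit star C e ;
  os_arch : matrix_archimedean C e }.

Definition positive_contraction C (e p : V) : Prop :=
  C 1%N p%:M /\ C 1%N (e - p)%:M.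

End StarMatrices.

Section CompleteOrderEmbedding.
Context {R : realType} {V W : lmodType R[i]}.

Definition completely_positive (CV : forall n, set 'M[V]_n)
    (CW : forall n, set 'M[W]_n) (f : V -> W) : Prop :=
  forall n (x : 'M[V]_n), CV n x -> CW n (map_mx f x).

(* coe_inv is complete positivity of the inverse f(V) -> V *)
Record complete_order_embedding (CV : forall n, set 'M[V]_n)
    (CW : forall n, set 'M[W]_n) (f : V -> W) : Prop := {
  coe_linear : linear f ;
  coe_inj : injective f ;
  coe_cp : completely_positive CV CW f ;
  coe_inv : forall n (x : 'M[V]_n), CW n (map_mx f x) -> CV n x }.

End CompleteOrderEmbedding.

Section Norm.
Context {R : realType} {H : lmodType R[i]} (dot : {dot H for Num.conj}).
Definition hnorm (x : H) : R := Num.sqrt (complex.Re (dot x x)).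
End Norm.

Record hilbertSpace (R : realType) := Hilbert {
  hsort :> lmodType R[i] ;
  hdot : {dot hsort for Num.conj} ;
  hcomplete : forall u : nat -> hsort,
    (forall eps : R, 0 < eps -> exists N, forall m n, (N <= m)%N -> (N <= n)%N ->
       hnorm hdot (u m - u n) < eps) ->
    exists l, forall eps : R, 0 < eps -> exists N, forall n, (N <= n)%N ->
       hnorm hdot (u n - l) < eps }.

Section BoundedOperators.
Context {R : realType} (H : hilbertSpace R).
Local Notation dot := (hdot H).
Local Notation norm := (hnorm dot).

Definition is_bounded_operator (f : H -> H) : Prop :=
  linear f /\ exists M : R, forall x, norm (f x) <= M * norm x.

Definition bounded_operator_pred : {pred H -> H} :=
  fun f => `[< is_bounded_operator f >].

Let normsqE (x : H) : norm x ^+ 2 = complex.Re (dot x x).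
Proof.
rewrite sqr_sqrtr //; have := dnorm_ge0 dot x.
by case: (dot x x) => a b; rewrite lecE => /andP[].
Qed.

Let normsqD (x y : H) : norm (x + y) ^+ 2 <= 2 * (norm x ^+ 2 + norm y ^+ 2).
Proof.
have -> : 2 * (norm x ^+ 2 + norm y ^+ 2)
    = norm (x + y) ^+ 2 + norm (x - y) ^+ 2.
  rewrite !normsqE (dnormD dot) (dnormB dot).
  case: (dot x x) => a b; case: (dot y y) => a' b'.
  by case: (_ + _^* ) => c d /=; rewrite addrACA subrr addr0 mulr2n mulrDl mul1r.
by rewrite lerDl sqr_ge0.
Qed.

Let normsqZ a (x : H) : norm (a *: x) ^+ 2 = Normc.normc a ^+ 2 * norm x ^+ 2.
Proof.
rewrite !normsqE (dnormZ dot).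
have -> : `|a| ^+ 2 = (Normc.normc a ^+ 2)%:C by rewrite rmorphXn.
by case: (dot x x) => b c /=; rewrite mul0r subr0.
Qed.

Lemma bounded_operator_submod : submod_closed bounded_operator_pred.
Proof.
split=> [|a f g /asboolP[lf [M fM]] /asboolP[lg [M' gM']]]; apply/asboolP.
  split=> [b x y|]; first by rewrite /= scaler0 addr0.
  exists 0 => x; rewrite mul0r.
  suff /eqP -> : norm ((0 : H -> H) x) == 0 by [].
  by rewrite -sqrf_eq0 normsqE; have /eqP -> : dot 0 0 == 0 by rewrite dnorm_eq0.
split=> [b x y|].
  rewrite -[LHS]/(a *: f (b *: x + y) + g (b *: x + y)).
  rewrite -[RHS]/(b *: (a *: f x + g x) + (a *: f y + g y)).
  by rewrite lf lg !scalerDr !scalerA (mulrC a) addrACA.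
exists (Num.sqrt (2 * (Normc.normc a ^+ 2 * M ^+ 2 + M' ^+ 2))) => x.
have n0 z : 0 <= norm z by rewrite sqrtr_ge0.
have c0 : 0 <= 2 * (Normc.normc a ^+ 2 * M ^+ 2 + M' ^+ 2).
  by rewrite mulr_ge0 ?ler0n // addr_ge0 ?sqr_ge0 // -exprMn sqr_ge0.
rewrite -[(a *: f + g) x]/(a *: f x + g x).
rewrite -(@ler_pXn2r _ 2) ?nnegrE ?mulr_ge0 ?sqrtr_ge0 //.
rewrite exprMn [X in _ <= X * _]sqr_sqrtr //.
apply: (le_trans (normsqD _ _)); rewrite -mulrA ler_wpM2l ?ler0n // mulrDl.
apply: lerD.
  rewrite normsqZ -[leRHS]mulrA ler_wpM2l ?sqr_ge0 // -exprMn ler_pXn2r ?nnegrE //.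
  exact: le_trans (n0 _) (fM x).
by rewrite -exprMn ler_pXn2r ?nnegrE //; exact: le_trans (n0 _) (gM' x).
Qed.

HB.instance Definition _ :=
  GRing.isSubmodClosed.Build _ _ bounded_operator_pred bounded_operator_submod.

Record boundedOperator := BoundedOperator {
  bop_fun :> H -> H ;
  bop_mem : bop_fun \in bounded_operator_pred }.

HB.instance Definition _ := [isSub for bop_fun].
HB.instance Definition _ := [Choice of boundedOperator by <:].
HB.instance Definition _ := [SubChoice_isSubLmodule of boundedOperator by <:].

End BoundedOperators.

Section BoundedOperatorOrder.
Context {R : realType} (H : hilbertSpace R).
Local Notation dot := (hdot H).

(* Positivity in M_n(B(H)) = B(H^n): the quadratic form is real and nonnegative. *)
Definition bop_cone n : set 'M[boundedOperator H]_n :=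
  [set T : 'M[boundedOperator H]_n | forall h : 'I_n -> H,
     0 <= \sum_i \sum_j dot (T i j (h j)) (h i)].

Definition is_projection (T : boundedOperator H) : Prop :=
  (forall x, T (T x) = T x) /\ (forall x y, dot (T x) y = dot x (T y)).

End BoundedOperatorOrder.

Definition abstract_projection (R : realType) (V : lmodType R[i])
    (C : forall n, set 'M[V]_n) (e p : V) : Prop :=
  positive_contraction C e p /\
  exists (H : hilbertSpace R) (pi : V -> boundedOperator H),
    [/\ complete_order_embedding C (@bop_cone R H) pi,
        forall x, pi e x = x
      & is_projection (pi p)].

Section LinearQuotient.
Context {K : fieldType} {W : lmodType K} (S : set W).

Definition lin_span : {pred W} := fun w =>
  `[< exists n (c : 'I_n -> K) (s : 'I_n -> W),
        (forall i, S (s i)) /\ w = \sum_i c i *: s i >].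

Lemma lin_span_submod : submod_closed lin_span.
Proof.
split=> [|a u v /asboolP[n [c [s [sS ->]]]] /asboolP[m [d [t [tS ->]]]]].
  apply/asboolP; exists 0%N, (fun _ => 0), (fun _ => 0).
  by split=> [[]|]; rewrite ?big_ord0.
apply/asboolP; exists (n + m)%N.
exists (fun i => match fintype.split i with inl j => a * c j | inr j => d j end).
exists (fun i => match fintype.split i with inl j => s j | inr j => t j end).
split=> [i|]; first by case: (fintype.split i).
rewrite big_split_ord scaler_sumr /=; congr (_ + _); apply: eq_bigr => i _.
  by rewrite (unsplitK (inl i)) scalerA.
by rewrite (unsplitK (inr i)).
Qed.

HB.instance Definition _ :=
  GRing.isSubmodClosed.Build _ _ lin_span lin_span_submod.

Definition lin_quot := Quotient.quot (lin_span : zmodClosed W).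
HB.instance Definition _ := GRing.Zmodule.on lin_quot.

Definition lq_pi (x : W) : lin_quot := \pi_(Quotient.quot (lin_span : zmodClosed W)) x.
Definition lq_repr (q : lin_quot) : W := repr q.

Let lq_reprK : cancel lq_repr lq_pi. Proof. exact: reprK. Qed.

Let lq_piP x y : (lq_pi x = lq_pi y) <-> (x - y \in lin_span).
Proof. by rewrite Quotient.idealrBE; split=> [e|/eqP //]; apply/eqP. Qed.

Let lq_piD x y : lq_pi (x + y) = lq_pi x + lq_pi y.
Proof. exact: raddfD. Qed.

Definition lq_scale (a : K) (q : lin_quot) : lin_quot := lq_pi (a *: lq_repr q).

Lemma lq_piZ a x : lq_pi (a *: x) = lq_scale a (lq_pi x).
Proof.
by apply/lq_piP; rewrite -scalerBr rpredZ //; apply/lq_piP; rewrite lq_reprK.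
Qed.

Let lq_scalerA a b q : lq_scale a (lq_scale b q) = lq_scale (a * b) q.
Proof. by rewrite -[q]lq_reprK -!lq_piZ scalerA. Qed.
Let lq_scale1 : left_id 1 lq_scale.
Proof. by move=> q; rewrite -[q]lq_reprK -!lq_piZ scale1r. Qed.
Let lq_scaleDr : right_distributive lq_scale +%R.
Proof.
move=> a q r; rewrite -[q]lq_reprK -[r]lq_reprK.
by rewrite -lq_piD -!lq_piZ -lq_piD scalerDr.
Qed.
Let lq_scaleDl q : {morph lq_scale^~ q : a b / a + b}.
Proof. by move=> a b; rewrite -[q]lq_reprK -!lq_piZ -lq_piD scalerDl. Qed.

HB.instance Definition _ := GRing.Zmodule_isLmodule.Build K lin_quot
  lq_scalerA lq_scale1 lq_scaleDr lq_scaleDl.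

End LinearQuotient.

(* An alias: 'M[V]_m itself carries no module structure over the scalars of V. *)
Definition matrixSpace (R : realType) (V : lmodType R[i]) (m : nat) := 'M[V]_m.

Section MatrixSpace.
Context {R : realType} {V : lmodType R[i]} {m : nat}.
HB.instance Definition _ := GRing.Zmodule.copy (matrixSpace V m) 'M[V]_m.

Let mxs (a : R[i]) (x : matrixSpace V m) : matrixSpace V m := mxscale a x.
Let mxsA a b x : mxs a (mxs b x) = mxs (a * b) x.
Proof. by apply/matrixP=> i j; rewrite !mxE scalerA. Qed.
Let mxs1 : left_id 1 mxs.
Proof. by move=> x; apply/matrixP=> i j; rewrite !mxE scale1r. Qed.
Let mxsDr : right_distributive mxs +%R.
Proof. by move=> a x y; apply/matrixP=> i j; rewrite !mxE scalerDr. Qed.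
Let mxsDl x : {morph mxs^~ x : a b / a + b}.
Proof. by move=> a b; apply/matrixP=> i j; rewrite !mxE scalerDl. Qed.

HB.instance Definition _ := GRing.Zmodule_isLmodule.Build R[i] (matrixSpace V m)
  mxsA mxs1 mxsDr mxsDl.
End MatrixSpace.

Section ConeQuotient.
Context {R : realType} {V : lmodType R[i]} {m : nat}.
Variable D : forall n, set 'M[V]_(n * m).

(* The identification of M_n(M_m(V)) with M_(nm)(V), in the Kronecker order. *)
Definition mxflatten n (x : 'M[matrixSpace V m]_n) : 'M[V]_(n * m) :=
  \matrix_(i, j) (x (mxtens_unindex i).1 (mxtens_unindex j).1 : 'M[V]_m)
                   (mxtens_unindex i).2 (mxtens_unindex j).2.

Definition cone_lineality : set (matrixSpace V m) :=
  [set x | D (mxflatten (x%:M : 'M_1)) /\ D (- mxflatten (x%:M : 'M_1))].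

Definition cone_quot : lmodType R[i] := lin_quot cone_lineality.

(* The image of D_n + M_n(J) in M_n(M_m(V)/J) = M_(nm)(V)/M_n(J); adding M_n(J)
   does not change the image. *)
Definition cone_quot_cone n : set 'M[cone_quot]_n :=
  [set map_mx (@lq_pi _ _ cone_lineality) x | x in [set x | D (@mxflatten n x)]].

(* const_mx x is x (x) J_m, J_m being the all-ones matrix. *)
Definition cone_quot_map (x : V) : cone_quot :=
  lq_pi cone_lineality (const_mx x : 'M[V]_m).

End ConeQuotient.
Arguments cone_quot_cone {R V m} D n.
Arguments cone_quot_map {R V m} D x.

Section ProjectionCones.
Context {R : realType} {V : lmodType R[i]}.
Variables (star : V -> V) (C : forall n, set 'M[V]_n) (e : V).

Definition kronl m n (a : 'M[R[i]]_m) (x : 'M[V]_n) : 'M[V]_(m * n) :=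
  \matrix_(i, j) (a (mxtens_unindex i).1 (mxtens_unindex j).1 *:
                  x (mxtens_unindex i).2 (mxtens_unindex j).2).
Definition kronr m n (x : 'M[V]_m) (a : 'M[R[i]]_n) : 'M[V]_(m * n) :=
  \matrix_(i, j) (a (mxtens_unindex i).2 (mxtens_unindex j).2 *:
                  x (mxtens_unindex i).1 (mxtens_unindex j).1).

Definition dsum (p q : V) : 'M[V]_2 :=
  block_mx (p%:M : 'M_1) 0 0 (q%:M : 'M_1).

Definition Cproj (p : V) n : set 'M[V]_(n * 2) :=
  [set x | mxstar star x = x /\
     forall eps : R, 0 < eps -> exists2 t : R, 0 < t &
       C (x + mxscale eps%:C (kronl (1%:M : 'M_n) (dsum p (e - p)))
            + mxscale t%:C (kronl (1%:M : 'M_n) (dsum (e - p) p)))].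

Section Several.
Variables (N : nat) (p : 'I_N -> V).

Lemma kron_dim (k : 'I_N) : (2 ^ k * (2 * 2 ^ (N - k.+1)) = 2 ^ N)%N.
Proof. by rewrite -expnS -expnD -subSn // subSS subnKC // ltnW. Qed.

(* 'I_N starts at 0: the index k stands for k + 1 in the usual numbering. *)
Definition spread (k : 'I_N) (y : 'M[V]_2) : 'M[V]_(2 ^ N) :=
  castmx (kron_dim k, kron_dim k)
    (kronl (1%:M : 'M_(2 ^ k)) (kronr y (const_mx 1 : 'M_(2 ^ (N - k.+1))))).

Definition Pmx (k : 'I_N) : 'M[V]_(2 ^ N) := spread k (dsum (p k) (e - p k)).
Definition Qmx (k : 'I_N) : 'M[V]_(2 ^ N) := spread k (dsum (e - p k) (p k)).

Definition perturbed_mem n (x : 'M[V]_(n * 2 ^ N)) (eps t : 'I_N -> R) : Prop :=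
  C (x + \sum_k mxscale (eps k)%:C (kronl (1%:M : 'M_n) (Pmx k))
       + \sum_k mxscale (t k)%:C (kronl (1%:M : 'M_n) (Qmx k))).

(* In the last clause only eps_i is decreased and only t_i is increased; the
   other eps_k and t_k are kept. *)
Definition Cprojs n : set 'M[V]_(n * 2 ^ N) :=
  [set x | mxstar star x = x /\
     forall eps : 'I_N -> R, (forall k, 0 < eps k) ->
       exists t : 'I_N -> R,
         [/\ forall k, 0 < t k,
             perturbed_mem x eps t
           & forall i (eps' : R), 0 < eps' < eps i ->
               exists2 t' : R, t i < t' &
                 perturbed_mem x [eta eps with i |-> eps'] [eta t with i |-> t']]].

End Several.
End ProjectionCones.

(* Main.v *)
Require Import Defs.
From HB Require Import structures.
From mathcomp Require Import all_boot all_order all_algebra.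
From mathcomp Require Import generic_quotient ring_quotient sesquilinear.
From mathcomp Require Import boolp classical_sets functions reals.
From mathcomp Require Import complex mxtens.
From mathcomp Require Import ring lra.

(**
Write [x (x) J] for the ampliation of [x] in [M_n(V)].  After unfolding the
quotients, (2) says that [x (x) J_2] in [C(p_i)_n] forces [x] in [C_n], and (3)
says the same for [x (x) J_(2^N)] in [C(p_1, .., p_N)_n].

(1) -> (2): in a representation where [p] is a projection, the form of
[x (x) J_2 + eps P + t Q] at the vectors [(p h_i, p^perp h_i)] is
[<x h, h> + eps |h|^2], as [Q] vanishes there.

(2) -> (1): if [x] is hermitian and not in [C_n], a maximal cone argument gives a
functional [F] on [M_(2n)(V)] nonnegative on [C(p)_n] and negative at [x (x) J_2].
Its Choi matrix [psi : V -> M_(2n)] is completely positive, and [F (I (x) Q) = 0]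
makes [psi p = psi e * E] for a coordinate projection [E].  Compressing [psi] by
[(psi e)^(-1/2)] gives a unital completely positive map which sends [p] to a projection
and is still negative at [x].  The l2-direct sum of all unital completely positive
maps into matrices that send [p] to a projection is therefore a complete order
embedding.

(2) -> (3): if [z (x) J_2 + eps P + t Q >= 0] for a single [t], then
[z + eps (I (x) e) >= 0] under (2), and [eps (I (x) e) (x) I_2 = eps (P + Q)] is
absorbed by the term of the next projection; so the projections can be peeled off
one after the other.

(3) -> (2): [J_m <= m I_m].
*)

Set Implicit Arguments.
Unset Strict Implicit.
Unset Printing Implicit Defensive.

Import Order.TTheory GRing.Theory Num.Theory.
Local Open Scope classical_set_scope.
Local Open Scope ring_scope.
Local Open Scope complex_scope.

(** The space [J] is never computed. The image of [C(p)_n + M_n(J)] in the quotient is not visibly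
    hermitian, so removing the quotient takes an argument: for [Z] in [M_n(J)], both [Z] and [c Z]
    plus their adjoints lie in the cone. The first controls the hermitian part of [x]; the second,
    with [c = i] and [c = - i], forces [x] to be hermitian.

    Separation rests on [P + Q = I (x) e]: a small multiple of the unit splits between the eps term
    and the t term, which makes [C(p)_n] Archimedean. Moreover [C(p)_n] contains the negative of
    each diagonal entry of [I (x) Q], so the Choi matrices have zero diagonal entries there, and
    positive semidefiniteness turns these into zero columns. This cuts [psi p] out of [psi e].

    As [psi e] may be singular, its inverse square root is replaced by a rectangular [B] with
    [B^* (psi e) B = 1]. The direct sum acts by bounded operators because one constant, read off
    from an order unit in [C_2], bounds all the maps of the family at a given [v]. *)

Section LinearMaps.
Variables (K : nzRingType) (U W : lmodType K) (f : U -> W).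
Hypothesis lin : linear f.

Lemma linear_fun0 : f 0 = 0.
Proof. by have := lin (-1) 0 0; rewrite !scaleN1r oppr0 addr0 addNr. Qed.

Lemma linear_funZ a u : f (a *: u) = a *: f u.
Proof. by have := lin a u 0; rewrite !addr0 linear_fun0 addr0. Qed.

Lemma linear_funD u v : f (u + v) = f u + f v.
Proof. by have := lin 1 u v; rewrite !scale1r. Qed.

Lemma linear_funB u v : f (u - v) = f u - f v.
Proof. by have := lin (-1) v u; rewrite !scaleN1r => h; rewrite [u - v]addrC h addrC. Qed.

End LinearMaps.

Lemma conj_real (R : realType) (a : R) : Num.conj (a%:C : R[i]) = a%:C.
Proof. exact: conjc_real. Qed.

Lemma conj_i (R : realType) : Num.conj ('i : R[i]) = - 'i.
Proof. by apply/eqP; rewrite eq_complex /= oppr0 !eqxx. Qed.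

Lemma RtoC_ge0P (R : realType) (z : R[i]) : 0 <= z -> exists a : R, z = a%:C.
Proof. by move=> z0; exists (complex.Re z); rewrite RRe_real // ger0_real. Qed.

Lemma RtoC_gt0P (R : realType) (z : R[i]) : 0 < z -> exists2 a : R, 0 < a & z = a%:C.
Proof. by case: z => a b; rewrite ltcE /= => /andP[/eqP-> a0]; exists a. Qed.

(** * Separation from a cone in a space with an order unit *)

Section ConvexCones.
Variables (R : realType) (W : lmodType R[i]).
Implicit Types (K M : set W).

Definition convex_cone K : Prop :=
  (forall x y, K x -> K y -> K (x + y)) /\
  (forall (r : R) x, 0 < r -> K x -> K (r%:C *: x)).

(** Zorn's lemma on the sets [A] whose union with [K] is a cone avoiding [w]. Adjoining [K] makes
    the empty chain admissible. *)
Lemma maximal_cone_avoiding K w : convex_cone K -> ~ K w ->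
  exists M, [/\ K `<=` M, convex_cone M, ~ M w
    & forall M', M `<=` M' -> convex_cone M' -> ~ M' w -> M' `<=` M].
Proof.
move=> [KD KZ] Kw.
pose P A := convex_cone (A `|` K) /\ ~ (A `|` K) w.
have [F FP Ftot|A [[[AD AZ] Aw] Amax]] := @Zorn_bigcup _ P.
  split=> [|[[A FA Aw]|//]]; last by have [_] := FP _ FA; apply; left.
  split=> [x y|r x r0].
    move=> [[A FA Ax]|Kx] [[B FB By]|Ky].
    - have [AB|BA] := Ftot _ _ FA FB.
        have [[BD _] _] := FP _ FB; have := BD x y (or_introl (AB _ Ax)) (or_introl By).
        by case; [left; exists B|right].
      have [[BD _] _] := FP _ FA; have := BD x y (or_introl Ax) (or_introl (BA _ By)).
      by case; [left; exists A|right].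
    - have [[BD _] _] := FP _ FA; have := BD x y (or_introl Ax) (or_intror Ky).
      by case; [left; exists A|right].
    - have [[BD _] _] := FP _ FB; have := BD x y (or_intror Kx) (or_introl By).
      by case; [left; exists B|right].
    - by right; exact: KD.
  move=> [[A FA Ax]|Kx]; last by right; exact: KZ.
  have [[_ AZ] _] := FP _ FA; have := AZ r x r0 (or_introl Ax).
  by case; [left; exists A|right].
exists (A `|` K); split=> [x Kx|||]; [by right|by split|by []|].
move=> M' AM' cM' wM' x xM'; apply: contrapT => nAx.
apply: (Amax M').
  split=> [z Az|sub]; first by apply: AM'; left.
  by apply: nAx; left; apply: sub.
have -> // : P M' = (convex_cone M' /\ ~ M' w).
rewrite /P; suff -> : M' `|` K = M' by [].
by apply/seteqP; split=> [z [//|Kz]|z]; [apply: AM'; right|left].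
Qed.

(** A maximal cone [M] avoiding [- u] contains [w] or [- w] for every [w]; the functional at [w] is
    then the supremum of the [r] with [w - r u] in [M]. Strict negativity at [y] comes from forcing
    into [M] the negative of a point slightly above [y]. *)
Lemma cone_separation K (u y : W) : convex_cone K -> ~ K (- u) ->
    (forall x, exists2 r : R, 0 < r & K (r%:C *: u - x)) ->
    (forall x, (forall r : R, 0 < r -> K (r%:C *: u + x)) -> K x) ->
    ~ K y ->
  exists f : W -> R, [/\ forall a b, f (a + b) = f a + f b,
    forall (r : R) a, f (r%:C *: a) = r * f a,
    forall a, K a -> 0 <= f a & f y < 0].
Proof.
move=> [KD KZ] Ku unitK archK Ky.
have Cinj (a b : R) : a%:C *: u + b%:C *: u = (a + b)%:C *: u.
  by rewrite -scalerDl -rmorphD.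
have KuP (r : R) : 0 < r -> K (r%:C *: u).
  move=> r0; have [s s0] := unitK 0; rewrite subr0 => /(KZ (r / s)).
  by rewrite scalerA -rmorphM /= divfK ?gt_eqF//; apply; rewrite divr_gt0.
(* The Archimedean property leaves room [d], which becomes the bound [f y <= - d] at the end. *)
have [d d0 Kyd] : exists2 d : R, 0 < d & ~ K (d%:C *: u + y).
  apply: contrapT => h; apply: Ky; apply: archK => r r0.
  by apply: contrapT => h'; apply: h; exists r.
set z := d%:C *: u + y.
pose K1 := [set x | exists2 k, (k = 0 \/ K k) & exists2 s : R, 0 <= s & x = k - s%:C *: z].
have K1cone : convex_cone K1.
  split=> [x x' [k hk [s s0 ->]] [k' hk' [s' s0' ->]]|r x r0 [k hk [s s0 ->]]].
    exists (k + k').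
      case: hk hk' => [->|hk] [->|hk']; rewrite ?add0r ?addr0; [by left|by right|by right|].
      by right; apply: KD.
    exists (s + s'); first exact: addr_ge0.
    by rewrite rmorphD scalerDl opprD addrACA.
  exists (r%:C *: k).
    case: hk => [->|hk]; [by left; rewrite scaler0|by right; apply: KZ].
  exists (r * s); first by rewrite mulr_ge0// ltW.
  by rewrite scalerBr scalerA -rmorphM.
have K1u : ~ K1 (- u).
  move=> [k hk [s s0 /eqP]]; rewrite eq_sym subr_eq => /eqP ks.
  have [s00|sgt0] := eqVneq s 0.
    move: ks; rewrite s00 scale0r addr0 => ku.
    have {}hk : K (- u).
      case: hk => [k0|]; last by rewrite ku.
      have u0 : u = 0 by rewrite -[u]opprK -ku k0 oppr0.
      by have := KuP 1 ltr01; rewrite u0 scaler0 oppr0.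
    exact: Ku.
  have {}s0 : 0 < s by rewrite lt0r sgt0.
  apply: Kyd; rewrite -/z.
  have -> : z = (s^-1)%:C *: (k + 1%:C *: u).
    by rewrite ks scale1r addrAC addNr add0r scalerA -rmorphM /= mulVf ?gt_eqF // scale1r.
  apply: KZ; first by rewrite invr_gt0.
  case: hk => [->|hk]; first by rewrite add0r; apply: KuP.
  by apply: KD => //; apply: KuP.
have [M [K1M [MD MZ] Mu Mmax]] := maximal_cone_avoiding K1cone K1u.
have KM x : K x -> M x.
  move=> Kx; apply: K1M; exists x; first by right.
  by exists 0; rewrite // scale0r subr0.
have M0 : M 0.
  by apply: K1M; exists 0; [left|exists 0; rewrite ?scale0r ?subr0].
have Mneg (r : R) : M (r%:C *: u) -> 0 <= r.
  move=> Mr; rewrite leNgt; apply/negP => r0; apply: Mu.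
  have -> : - u = ((- r)^-1)%:C *: (r%:C *: u).
    by rewrite scalerA -rmorphM /= invrN mulNr mulVf ?lt_eqF// rmorphN scaleN1r.
  by apply: MZ; rewrite // invr_gt0 oppr_gt0.
have Mpos (r : R) : 0 <= r -> M (r%:C *: u).
  rewrite le0r => /orP[/eqP->|r0]; first by rewrite scale0r.
  by apply: KM; apply: KuP.
(* If neither [w] nor [- w] were in [M], maximality would put [- u] in both enlarged cones;
   combining the two expressions cancels [w] and leaves a negative multiple of [u] in [M]. *)
have Mtot w : M w \/ M (- w).
  apply: contrapT => /not_orP[nw nNw].
  have ext v : ~ M v -> exists2 s : R, 0 < s & M (- u - s%:C *: v).
    move=> nv; apply: contrapT => h; apply: nv.
    pose M' := [set x | exists2 m, M m & exists2 s : R, 0 <= s & x = m + s%:C *: v].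
    suff M'M : M' `<=` M.
      by apply: M'M; exists 0 => //; exists 1; rewrite // add0r scale1r.
    apply: Mmax.
    - by move=> x Mx; exists x => //; exists 0; rewrite // scale0r addr0.
    - split=> [x x' [k hk [s s0 ->]] [k' hk' [s' s0' ->]]|r x r0 [k hk [s s0 ->]]].
        exists (k + k'); first exact: MD.
        exists (s + s'); first exact: addr_ge0.
        by rewrite rmorphD scalerDl addrACA.
      exists (r%:C *: k); first exact: MZ.
      exists (r * s); first by rewrite mulr_ge0// ltW.
      by rewrite scalerDr scalerA -rmorphM.
    - move=> [m Mm [s s0 um]]; move: s0; rewrite le0r => /orP[/eqP s0|s0].
        by apply: Mu; rewrite um s0 scale0r addr0.
      by apply: h; exists s => //; rewrite um addrK.
  have [s s0 Ms] := ext _ nw; have [s' s0' Ms'] := ext _ nNw.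
  have : M ((- (s + s'))%:C *: u).
    have -> : (- (s + s'))%:C *: u =
       s'%:C *: (- u - s%:C *: w) + s%:C *: (- u - s'%:C *: - w).
      rewrite !scalerBr !scalerN !scalerA -!rmorphM [s * s']mulrC opprK addrACA addNr.
      by rewrite addr0 rmorphN scaleNr rmorphD scalerDl opprD addrC.
    by apply: MD; apply: MZ.
  by move/Mneg; rewrite oppr_ge0 leNgt addr_gt0.
pose S w := [set r : R | M (w - r%:C *: u)].
pose f w := sup (S w).
have Sne w : S w !=set0.
  have [r r0 Kr] := unitK (- w); exists (- r); rewrite /S /= rmorphN scaleNr opprK addrC.
  by apply: KM; move: Kr; rewrite opprK.
have Sub w : has_ubound (S w).
  have [r r0 Kr] := unitK w; exists r => t St.
  have := MD _ _ (KM _ Kr) St; rewrite addrA subrK -scaleNr -rmorphN Cinj.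
  by move/Mneg; rewrite subr_ge0.
have fle w r : M (w - r%:C *: u) -> r <= f w by move=> h; apply: ub_le_sup.
have fge w r : r < f w -> M (w - r%:C *: u).
  move=> /(sup_gt (Sne w))[t St rt].
  have -> : w - r%:C *: u = w - t%:C *: u + (t - r)%:C *: u.
    by rewrite -Cinj addrA subrK rmorphN scaleNr.
  by apply: MD => //; apply: Mpos; rewrite subr_ge0 ltW.
have fsuper a b : f a + f b <= f (a + b).
  apply/ler_addgt0Pr => ep ep0; rewrite -lerBlDr; apply: fle.
  have -> : a + b - (f a + f b - ep)%:C *: u =
     (a - (f a - ep / 2)%:C *: u) + (b - (f b - ep / 2)%:C *: u).
    rewrite addrACA -opprD Cinj; congr (_ - _%:C *: _).
    by rewrite addrACA -opprD -splitr.
  by apply: MD; apply: fge; rewrite ltrBlDr ltrDl divr_gt0.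
(* Totality of [M] enters here: it upgrades superadditivity of the supremum to additivity. *)
have fNge a : - f a <= f (- a).
  apply/ler_addgt0Pr => ep ep0; rewrite -lerBlDr; apply: (fle).
  have [Ma|] := Mtot (a - (f a + ep)%:C *: u).
    by have := fle _ _ Ma; rewrite gerDl leNgt ep0.
  by rewrite opprB [X in M X -> _]addrC -[- f a - ep]opprD rmorphN scaleNr opprK.
have f0le : f 0 <= 0.
  apply: ge_sup => // r; rewrite /S /= sub0r -scaleNr -rmorphN => /Mneg.
  by rewrite oppr_ge0.
have fN a : f (- a) = - f a.
  apply/eqP; rewrite eq_le fNge andbT -subr_le0 opprK addrC.
  by have := fsuper a (- a); rewrite subrr => /le_trans; apply.
have fD a b : f (a + b) = f a + f b.
  apply/eqP; rewrite eq_le fsuper andbT.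
  by have := fsuper (- a) (- b); rewrite -opprD !fN -opprD lerN2.
have fZp (r : R) a : 0 < r -> r * f a <= f (r%:C *: a).
  move=> r0; apply/ler_addgt0Pr => ep ep0; rewrite -lerBlDr; apply: fle.
  have -> : r * f a - ep = r * (f a - ep / r).
    by rewrite mulrBr [r * (_ / _)]mulrC divfK ?gt_eqF.
  rewrite rmorphM -scalerA -scalerBr; apply: MZ => //; apply: fge.
  by rewrite ltrBlDr ltrDl divr_gt0.
have fZ0 (r : R) a : 0 < r -> f (r%:C *: a) = r * f a.
  move=> r0; apply/eqP; rewrite eq_le fZp // andbT.
  have r0' : 0 < r^-1 by rewrite invr_gt0.
  have := fZp r^-1 (r%:C *: a) r0'.
  by rewrite scalerA -rmorphM /= mulVf ?gt_eqF// scale1r -(ler_pM2l r0) mulrA divff ?gt_eqF // mul1r.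
exists f; split=> //.
- move=> r a; have [r0|r0|->] := ltgtP r 0.
  + by rewrite -[r]opprK rmorphN scaleNr fN fZ0 ?oppr_gt0// !mulNr.
  + exact: fZ0.
  + have := fD 0 0; rewrite addr0 scale0r mul0r => /eqP.
    by rewrite -subr_eq subrr => /eqP.
- by move=> a Ka; apply: fle; rewrite scale0r subr0; apply: KM.
- have : 0 <= f (- z).
    apply: (fle); rewrite scale0r subr0; apply: K1M.
    by exists 0; [left|exists 1; [|rewrite sub0r scale1r]].
  rewrite fN /z fD oppr_ge0 => h.
  have : d <= f (d%:C *: u) by apply: fle; rewrite subrr.
  by move: h d0; lra.
Qed.

End ConvexCones.

(** * Squared modulus, and closedness of the nonnegative complex numbers *)

Section ComplexModulus.
Variable R : realType.
Implicit Types z w : R[i].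

Definition sqmod z : R := complex.Re z ^+ 2 + complex.Im z ^+ 2.

Lemma sqmodE z : (sqmod z)%:C = z * Num.conj z.
Proof.
case: z => a b; apply/eqP; rewrite eq_complex /sqmod /=.
by apply/andP; split; apply/eqP; ring.
Qed.

Lemma sqmod_ge0 z : 0 <= sqmod z. Proof. by rewrite addr_ge0 ?sqr_ge0. Qed.

Lemma sqmod_eq0 z : sqmod z = 0 -> z = 0.
Proof.
case: z => a b /eqP; rewrite paddr_eq0 ?sqr_ge0 // !sqrf_eq0 /=.
by move=> /andP[/eqP-> /eqP->].
Qed.

Lemma sqmodM z w : sqmod (z * w) = sqmod z * sqmod w.
Proof. by case: z w => a b [c d]; rewrite /sqmod /=; ring. Qed.

Lemma sqmodN z : sqmod (- z) = sqmod z.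
Proof. by case: z => a b; rewrite /sqmod /=; ring. Qed.

Lemma sqmodD_le z w : sqmod (z + w) <= 2 * sqmod z + 2 * sqmod w.
Proof.
case: z w => a b [c d]; rewrite /sqmod /=.
by have := sqr_ge0 (a - c); have := sqr_ge0 (b - d); nra.
Qed.

Lemma Re_sqmod_le z (r : R) : 0 <= r -> sqmod z <= r ^+ 2 -> `|complex.Re z| <= r.
Proof.
move=> r0; case: z => a b; rewrite /sqmod /= => h.
by rewrite ler_norml; apply/andP; split; have := sqr_ge0 b; nra.
Qed.

Lemma Im_sqmod_le z (r : R) : 0 <= r -> sqmod z <= r ^+ 2 -> `|complex.Im z| <= r.
Proof.
move=> r0; case: z => a b; rewrite /sqmod /= => h.
by rewrite ler_norml; apply/andP; split; have := sqr_ge0 a; nra.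
Qed.

Lemma normE_sqmod z : `|z| ^+ 2 = (sqmod z)%:C.
Proof. by rewrite sqmodE sqr_normc. Qed.

(** It passes positivity to limits, both of infinite sums and of forms perturbed by a small eps. *)
Lemma ge0_approx l : (forall ep : R[i], 0 < ep -> exists2 z, 0 <= z & `|z - l| < ep) ->
  0 <= l.
Proof.
move=> h; rewrite lecE /=.
have h' (d : R) : 0 < d -> exists2 z, 0 <= z & sqmod (z - l) <= d ^+ 2.
  move=> d0; have [|z z0 zl] := h d%:C; first by rewrite ltcR.
  exists z => //; rewrite -lecR -normE_sqmod rmorphXn /=.
  by rewrite ler_pXn2r ?nnegrE ?normr_ge0 ?ler0c ?(ltW d0) ?(ltW zl).
apply/andP; split.
  rewrite -normr_eq0 eq_le normr_ge0 andbT; apply/ler_addgt0Pr => d d0.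
  rewrite add0r; have [z z0 /(Im_sqmod_le (ltW d0))] := h' d d0.
  move: z0 => /ger0_Im; case: z l {h h'} => a b [c e] /= ->; rewrite sub0r normrN; apply.
apply/ler_addgt0Pr => d d0; have [z z0 /(Re_sqmod_le (ltW d0))] := h' d d0.
move: z0; rewrite lecE => /andP[_]; case: z l {h h'} => a b [c e] /=.
by rewrite ler_norml => a0 /andP[]; lra.
Qed.

End ComplexModulus.

(** * Unconditional sums over an arbitrary index set *)

Section UnconditionalSums.
Variables (R : realType) (T : eqType).
Implicit Types (u v : T -> R[i]) (l : R[i]).

(** Convergence of the net of finite partial sums ordered by inclusion; [T] has no enumeration and
    may be uncountable. *)
Definition sums_to u l := forall ep : R[i], 0 < ep ->
  exists s0 : seq T, forall s, uniq s -> {subset s0 <= s} ->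
    `|\sum_(t <- s) u t - l| < ep.

Lemma sums_toD u v l m : sums_to u l -> sums_to v m ->
  sums_to (fun t => u t + v t) (l + m).
Proof.
move=> ul vm ep ep0; have ep2 : 0 < ep / 2 by rewrite divr_gt0.
have [s1 h1] := ul _ ep2; have [s2 h2] := vm _ ep2.
exists (s1 ++ s2) => s us sub.
rewrite big_split /= opprD addrACA (le_lt_trans (ler_normD _ _))//.
rewrite [ep]splitr ltrD // ?h1 ?h2 // => t ts; apply: sub; rewrite mem_cat ts ?orbT //.
Qed.

Lemma sums_toZ u l (a : R[i]) : sums_to u l -> sums_to (fun t => a * u t) (a * l).
Proof.
move=> ul ep ep0; have a0 : 0 < `|a| + 1 by rewrite ltr_wpDl.
have [s0 h] := ul (ep / (`|a| + 1)) (divr_gt0 ep0 a0); exists s0 => s us sub.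
rewrite -mulr_sumr -mulrBr normrM.
apply: (@le_lt_trans _ _ ((`|a| + 1) * `|\sum_(t <- s) u t - l|)).
  by rewrite ler_wpM2r // lerDl.
by rewrite mulrC -ltr_pdivlMr // h.
Qed.

Lemma sums_to_conj u l : sums_to u l ->
  sums_to (fun t => Num.conj (u t)) (Num.conj l).
Proof.
move=> ul ep ep0; have [s0 h] := ul ep ep0; exists s0 => s us sub.
by rewrite -rmorph_sum -rmorphB norm_conjC h.
Qed.

Lemma sums_to0 : sums_to (fun=> 0) 0.
Proof.
by move=> ep ep0; exists [::] => s _ _; rewrite big1 // subrr normr0.
Qed.

Lemma eq_sums_to u v l : u =1 v -> sums_to u l -> sums_to v l.
Proof. by move=> /funext ->. Qed.

Lemma sums_to_sum (I : Type) (r : seq I) (u : I -> T -> R[i]) (l : I -> R[i]) :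
  (forall i, sums_to (u i) (l i)) ->
  sums_to (fun t => \sum_(i <- r) u i t) (\sum_(i <- r) l i).
Proof.
move=> h; elim: r => [|i r ih].
  by rewrite big_nil; apply: eq_sums_to sums_to0 => t; rewrite big_nil.
rewrite big_cons; apply: eq_sums_to (sums_toD (h i) ih) => t.
by rewrite big_cons.
Qed.

(** For the direct sum below, positivity and symmetry of partial sums are known only over unions of
    whole blocks, and such unions are cofinal. *)
Definition cofinally (P : seq T -> Prop) :=
  forall s0 : seq T, exists s, [/\ uniq s, {subset s0 <= s} & P s].

Lemma sums_to_ge0 u l : sums_to u l -> cofinally (fun s => 0 <= \sum_(t <- s) u t) ->
  0 <= l.
Proof.
move=> ul cof; apply: ge0_approx => ep ep0.
have [s0 h] := ul ep ep0; have [s [us sub s_ge0]] := cof s0.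
by exists (\sum_(t <- s) u t) => //; apply: h.
Qed.

Lemma eq_sums_to_cofinal u v l m : sums_to u l -> sums_to v m ->
  cofinally (fun s => \sum_(t <- s) u t = \sum_(t <- s) v t) -> l = m.
Proof.
move=> ul vm cof; apply/eqP; rewrite -subr_eq0 eq_le.
have uv := sums_toD ul (sums_toZ (-1) vm).
rewrite mulN1r in uv.
have h0 : cofinally (fun s => \sum_(t <- s) (u t + -1 * v t) = 0).
  move=> s0; have [s [us sub e]] := cof s0; exists s; split=> //.
  by rewrite big_split -mulr_sumr /= e mulN1r subrr.
apply/andP; split.
  rewrite -oppr_ge0 -mulN1r; apply: sums_to_ge0 (sums_toZ (-1) uv) _ => s0.
  have [s [us sub e]] := h0 s0; exists s; split=> //.
  by rewrite -mulr_sumr e mulr0.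
apply: sums_to_ge0 uv _ => s0.
by have [s [us sub e]] := h0 s0; exists s; split=> //; rewrite e.
Qed.

Lemma cofinallyT : cofinally (fun=> True).
Proof.
move=> s0; exists (undup s0); split=> //; first exact: undup_uniq.
by move=> t; rewrite mem_undup.
Qed.

Lemma sums_to_unique u l m : sums_to u l -> sums_to u m -> l = m.
Proof.
move=> ul um; apply: eq_sums_to_cofinal ul um _ => s0.
by have [s [us sub _]] := cofinallyT s0; exists s.
Qed.

Lemma sum_incl (Z : nmodType) (u : T -> Z) s s0 : uniq s -> uniq s0 -> {subset s0 <= s} ->
  \sum_(t <- s) u t = \sum_(t <- s0) u t + \sum_(t <- s | t \notin s0) u t.
Proof.
move=> us us0 sub; rewrite (bigID (mem s0)) /=; congr (_ + _).
rewrite -big_filter; apply: perm_big; apply: uniq_perm => //; first exact: filter_uniq.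
by move=> t; rewrite mem_filter; apply/andP/idP => [[]//|ts]; split => //; apply: sub.
Qed.

Lemma sums_to_finite u s0 : uniq s0 -> (forall t, t \notin s0 -> u t = 0) ->
  sums_to u (\sum_(t <- s0) u t).
Proof.
move=> us0 u0 ep ep0; exists s0 => s us sub.
by rewrite (sum_incl u us us0 sub) addrAC subrr add0r big1 // normr0.
Qed.

Lemma sums_to_bounded (f : T -> R) (M : R) : (forall t, 0 <= f t) ->
  (forall s, uniq s -> \sum_(t <- s) f t <= M) ->
  exists l : R, [/\ sums_to (fun t => (f t)%:C) l%:C, l <= M
    & forall s, uniq s -> \sum_(t <- s) f t <= l].
Proof.
move=> f0 fM; pose S := [set r | exists2 s, uniq s & r = \sum_(t <- s) f t].
have ne : S !=set0 by exists 0; exists [::] => //; rewrite big_nil.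
have ub : has_ubound S by exists M => _ [s us ->]; exact: fM.
have le s : uniq s -> \sum_(t <- s) f t <= sup S.
  by move=> us; apply: ub_le_sup => //; exists s.
exists (sup S); split=> //; last by apply: ge_sup => // _ [s us ->]; exact: fM.
move=> ep ep0; have [a e0 epE] := RtoC_gt0P ep0.
have [_ [s0 us0 ->] lt] := sup_adherent e0 (conj ne ub).
exists s0 => s us sub.
have h1 : \sum_(t <- s0) f t <= \sum_(t <- s) f t.
  by rewrite (sum_incl f us us0 sub) lerDl sumr_ge0.
rewrite -rmorph_sum -rmorphB /= epE.
have -> : `|(\sum_(t <- s) f t - sup S)%:C| = `|\sum_(t <- s) f t - sup S|%:C.
  by rewrite normc_def /= expr0n addr0 sqrtr_sqr.
rewrite ltcR distrC ger0_norm ?subr_ge0 ?le //.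
by move: lt h1; lra.
Qed.

End UnconditionalSums.

(** * Square summable families *)

(** The limit is the supremum of the eventual lower bounds, that is, the limit inferior. *)
Lemma cauchy_realType (R : realType) (x : nat -> R) :
  (forall ep : R, 0 < ep -> exists N, forall m n, (N <= m)%N -> (N <= n)%N ->
     `|x m - x n| <= ep) ->
  exists l, forall ep : R, 0 < ep -> exists N, forall n, (N <= n)%N -> `|x n - l| <= ep.
Proof.
move=> cx; pose S := [set a | exists N, forall n, (N <= n)%N -> a <= x n].
have low ep : 0 < ep -> exists N, forall n, (N <= n)%N -> S (x n - ep) /\
    ubound S (x n + ep).
  move=> e0; have [N h] := cx _ e0; exists N => n Nn; split.
    by exists N => m Nm; have := h n m Nn Nm; rewrite ler_norml => /andP[_]; lra.
  move=> a [M hM]; apply: (le_trans (hM (maxn N M) (leq_maxr _ _))).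
  have := h n _ Nn (leq_maxl N M); rewrite ler_norml => /andP[]; lra.
exists (sup S) => ep e0; have [N h] := low ep e0; exists N => n Nn.
have [Sn ubn] := h n Nn.
rewrite ler_norml; apply/andP; split.
  have : sup S <= x n + ep by apply: ge_sup => //; exists (x n - ep).
  lra.
have : x n - ep <= sup S by apply: ub_le_sup => //; exists (x n + ep).
lra.
Qed.

Section SquareSummable.
Variables (R : realType) (T : eqType).

Definition sqsummable_pred : {pred T -> R[i]} := fun h =>
  `[< exists M : R, forall s, uniq s -> \sum_(t <- s) sqmod (h t) <= M >].

Lemma sqsummable_submod : submod_closed sqsummable_pred.
Proof.
split=> [|a f g /asboolP[M fM] /asboolP[M' gM']]; apply/asboolP.
  by exists 0 => s us; rewrite big1 // => t _; rewrite /sqmod /= expr0n addr0.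
exists (2 * (sqmod a * M) + 2 * M') => s us.
apply: (@le_trans _ _ (2 * (sqmod a * \sum_(t <- s) sqmod (f t)) +
    2 * \sum_(t <- s) sqmod (g t))).
  rewrite !mulr_sumr -big_split /=; apply: ler_sum => t _.
  by rewrite -sqmodM; apply: sqmodD_le.
by rewrite lerD // ler_wpM2l // ?gM' // ler_wpM2l ?sqmod_ge0 ?fM.
Qed.

HB.instance Definition _ :=
  GRing.isSubmodClosed.Build _ _ sqsummable_pred sqsummable_submod.

Record l2 := L2 { l2_fun :> T -> R[i]; l2_mem : l2_fun \in sqsummable_pred }.

HB.instance Definition _ := [isSub for l2_fun].
HB.instance Definition _ := [Choice of l2 by <:].
HB.instance Definition _ := [SubChoice_isSubLmodule of l2 by <:].

Implicit Types g h : l2.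

Lemma l2E g h : (forall t, g t = h t) -> g = h.
Proof. by move=> e; apply: val_inj; apply: funext. Qed.

Lemma l2_linE (a : R[i]) g h t : (a *: g + h) t = a * g t + h t.
Proof. by []. Qed.

Lemma l2_bound h : exists M : R, forall s, uniq s -> \sum_(t <- s) sqmod (h t) <= M.
Proof. by have /asboolP := l2_mem h. Qed.

Lemma l2_sums_sqmod h : exists l : R, sums_to (fun t => (sqmod (h t))%:C) l%:C.
Proof.
have [M hM] := l2_bound h.
have [|l [sl _ _]] := sums_to_bounded _ hM; first by move=> t; apply: sqmod_ge0.
by exists l.
Qed.

(** Polarization: four times [g t * conj (h t)] is a combination of the squared moduli of [g + a h]
    for [a = 1, -1, i, -i], and these have convergent sums. *)
Lemma l2_sums_mul g h : exists l, sums_to (fun t => g t * Num.conj (h t)) l.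
Proof.
pose q (a : R[i]) := g + a *: h.
have [l1 s1] := l2_sums_sqmod (q 1); have [l2 s2] := l2_sums_sqmod (q (-1)).
have [l3 s3] := l2_sums_sqmod (q 'i); have [l4 s4] := l2_sums_sqmod (q (- 'i)).
exists (1 / 4 * (l1%:C + -1 * l2%:C + 'i * l3%:C + - 'i * l4%:C)).
have := sums_toZ (1/4) (sums_toD (sums_toD (sums_toD s1 (sums_toZ (-1) s2))
  (sums_toZ 'i s3)) (sums_toZ (- 'i) s4)).
apply: eq_sums_to => t.
have qE a : q a t = g t + a * h t by [].
rewrite !qE; case: (g t) => a b; case: (h t) => c d.
have -> : (1 / 4 : R[i]) = (1 / 4 : R)%:C by rewrite rmorphM fmorphV rmorphMn.
apply/eqP; rewrite eq_complex /sqmod /=.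
by apply/andP; split; apply/eqP; field.
Qed.

Definition l2dot g h : R[i] := sval (cid (l2_sums_mul g h)).

Lemma l2dotP g h : sums_to (fun t => g t * Num.conj (h t)) (l2dot g h).
Proof. exact: (svalP (cid (l2_sums_mul g h))). Qed.

Lemma l2dotC g h : l2dot g h = Num.conj (l2dot h g).
Proof.
apply: sums_to_unique (l2dotP g h) _; apply: eq_sums_to (sums_to_conj (l2dotP h g)) => t.
by rewrite rmorphM /= conjCK mulrC.
Qed.

Lemma l2dot_linl (a : R[i]) g g' h : l2dot (a *: g + g') h = a * l2dot g h + l2dot g' h.
Proof.
apply: sums_to_unique (l2dotP _ h) _.
apply: eq_sums_to (sums_toD (sums_toZ a (l2dotP g h)) (l2dotP g' h)) => t.
by rewrite l2_linE mulrDl mulrA.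
Qed.

Lemma l2dot0l h : l2dot 0 h = 0.
Proof. by have := l2dot_linl (-1) 0 0 h; rewrite scaleN1r oppr0 addr0 mulN1r addNr. Qed.

Lemma l2dot_linr (a : R[i]) g h h' :
  l2dot g (a *: h + h') = Num.conj a * l2dot g h + l2dot g h'.
Proof. by rewrite l2dotC l2dot_linl rmorphD rmorphM /= -!l2dotC. Qed.

Lemma l2dot_sqmod h : exists l : R, [/\ l2dot h h = l%:C,
  forall s, uniq s -> \sum_(t <- s) sqmod (h t) <= l
  & forall M, (forall s, uniq s -> \sum_(t <- s) sqmod (h t) <= M) -> l <= M].
Proof.
have sq0 t : 0 <= sqmod (h t) := sqmod_ge0 _.
have dotE (l : R) : sums_to (fun t => (sqmod (h t))%:C) l%:C -> l2dot h h = l%:C.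
  move=> sl; apply: sums_to_unique (l2dotP h h) _; apply: eq_sums_to sl => t.
  exact: sqmodE.
have [M hM] := l2_bound h; have [l [sl _ lub]] := sums_to_bounded sq0 hM.
exists l; split=> //; first exact: dotE.
move=> M' hM'; have [l' [sl' l'M _]] := sums_to_bounded sq0 hM'.
by have := dotE _ sl; rewrite (dotE _ sl') => /complexI <-.
Qed.

Lemma l2dot_gt0 h : h != 0 -> 0 < l2dot h h.
Proof.
move=> h0; have [l [-> le _]] := l2dot_sqmod h; rewrite ltcR lt_neqAle.
have l0 : 0 <= l by have := le [::] isT; rewrite big_nil.
rewrite l0 andbT; apply: contra h0 => /eqP l00; apply/eqP; apply: l2E => t.
apply: sqmod_eq0; apply/eqP; rewrite eq_le sqmod_ge0 andbT l00.
by have := le [:: t] isT; rewrite big_seq1.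
Qed.

HB.instance Definition _ := bilinear_isBilinear.Build R[i] l2 l2 R[i]
  *%R (Num.conj \; *%R) l2dot
  (fun h => (fun a g g' => l2dot_linl a g g' h), fun g => (fun a h h' => l2dot_linr a g h h')).

HB.instance Definition _ := isHermitianSesquilinear.Build R[i] l2 false Num.conj l2dot
  (fun g h => etrans (l2dotC g h) (esym (mul1r _))).
HB.instance Definition _ := isDotProduct.Build R[i] l2 l2dot l2dot_gt0.

Definition l2_dot : {dot l2 for Num.conj} := l2dot.

Lemma hnorm_l2_lt h (r : R) : hnorm l2_dot h < r ->
  forall s, uniq s -> \sum_(t <- s) sqmod (h t) <= r ^+ 2.
Proof.
have [l [e le lub]] := l2dot_sqmod h; rewrite /hnorm /= e /= => hr s us.
have l0 : 0 <= l by have := le [::] isT; rewrite big_nil.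
apply: (le_trans (le s us)); rewrite -(sqr_sqrtr l0).
by rewrite ler_pXn2r ?nnegrE ?sqrtr_ge0 ?(ltW hr) // (le_trans (sqrtr_ge0 l)) // ltW.
Qed.

Lemma hnorm_l2_le h (r : R) : 0 <= r ->
  (forall s, uniq s -> \sum_(t <- s) sqmod (h t) <= r ^+ 2) -> hnorm l2_dot h <= r.
Proof.
move=> r0 hr; have [l [e le lub]] := l2dot_sqmod h; rewrite /hnorm /= e /=.
have l0 : 0 <= l by have := le [::] isT; rewrite big_nil.
by rewrite -(@ler_pXn2r _ 2) ?nnegrE ?sqrtr_ge0 // sqr_sqrtr // lub.
Qed.

Lemma sqr_hnorm_l2 h s : uniq s -> \sum_(t <- s) sqmod (h t) <= hnorm l2_dot h ^+ 2.
Proof.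
have [l [e le lub]] := l2dot_sqmod h; rewrite /hnorm /= e /= => us.
have l0 : 0 <= l by have := le [::] isT; rewrite big_nil.
by rewrite sqr_sqrtr // le.
Qed.

Lemma l2_complete (u : nat -> l2) :
    (forall eps : R, 0 < eps -> exists N, forall m n, (N <= m)%N -> (N <= n)%N ->
       hnorm l2_dot (u m - u n) < eps) ->
    exists l, forall eps : R, 0 < eps -> exists N, forall n, (N <= n)%N ->
       hnorm l2_dot (u n - l) < eps.
Proof.
move=> cu.
have ptw (m n : nat) t : (u m - u n) t = u m t - u n t by [].
have cpt t (eps : R) : 0 < eps -> exists N, forall m n, (N <= m)%N -> (N <= n)%N ->
    sqmod (u m t - u n t) <= eps ^+ 2.
  move=> e0; have [N h] := cu _ e0; exists N => m n Nm Nn.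
  by have := hnorm_l2_lt (h m n Nm Nn) (s := [:: t]) isT; rewrite big_seq1 ptw.
have lim t : exists l : R[i], forall eps : R, 0 < eps -> exists N, forall n, (N <= n)%N ->
    sqmod (u n t - l) <= eps.
  have [|a ha] := @cauchy_realType R (fun n => complex.Re (u n t)).
    move=> eps e0; have [N h] := cpt t eps e0; exists N => m n Nm Nn.
    by rewrite -raddfB /=; apply: Re_sqmod_le; [apply: ltW|apply: h].
  have [|b hb] := @cauchy_realType R (fun n => complex.Im (u n t)).
    move=> eps e0; have [N h] := cpt t eps e0; exists N => m n Nm Nn.
    by rewrite -raddfB /=; apply: Im_sqmod_le; [apply: ltW|apply: h].
  exists (a +i* b) => eps e0.
  have m0 : 0 < Num.min (eps / 2) 1 by rewrite lt_min ltr01 divr_gt0.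
  have [N hN] := ha _ m0; have [M hM] := hb _ m0; exists (maxn N M) => n.
  rewrite geq_max => /andP[/hN na /hM nb]; move: na nb.
  case: (u n t) => c d; rewrite /sqmod /= !le_min !ler_norml.
  by move=> /andP[/andP[? ?] /andP[? ?]] /andP[/andP[? ?] /andP[? ?]]; nra.
have /choice[l hl] := lim.
have lims (s : seq T) (eps : R) : 0 < eps -> exists N, forall n, (N <= n)%N ->
    \sum_(t <- s) sqmod (u n t - l t) <= eps.
  elim: s eps => [|t s ih] eps e0; first by exists 0%N => n _; rewrite big_nil ltW.
  have e2 : 0 < eps / 2 by rewrite divr_gt0.
  have [N hN] := ih _ e2; have [M hM] := hl t _ e2; exists (maxn N M) => n.
  rewrite geq_max => /andP[/hN na /hM nb]; rewrite big_cons [eps]splitr.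
  exact: lerD.
(* The intermediate index [n] may depend on [s] but the threshold [N] does not, so the bound is
   uniform over finite sets. The factor [4] is [2 + 2] from [sqmodD_le]. *)
have bnd (eps : R) : 0 < eps -> exists N, forall m, (N <= m)%N ->
    forall s, uniq s -> \sum_(t <- s) sqmod (u m t - l t) <= 4 * eps ^+ 2.
  move=> e0; have [N hN] := cu _ e0; exists N => m Nm s us.
  have [M hM] := lims s (eps ^+ 2) (exprn_gt0 _ e0); pose n := maxn N M.
  have h1 := hnorm_l2_lt (hN m n Nm (leq_maxl _ _)) us.
  have h2 := hM n (leq_maxr _ _).
  apply: (@le_trans _ _ (2 * \sum_(t <- s) sqmod ((u m - u n) t)
     + 2 * \sum_(t <- s) sqmod (u n t - l t))); last by lra.
  rewrite !mulr_sumr -big_split; apply: ler_sum => t _ /=.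
  have -> : u m t - l t = (u m - u n) t + (u n t - l t) by rewrite ptw addrA subrK.
  exact: sqmodD_le.
have lmem : (l : T -> R[i]) \in sqsummable_pred.
  have [N hN] := bnd 1 ltr01; have [M hM] := l2_bound (u N).
  apply/asboolP; exists (2 * M + 2 * (4 * 1 ^+ 2)) => s us.
  apply: (@le_trans _ _ (2 * \sum_(t <- s) sqmod (u N t)
     + 2 * \sum_(t <- s) sqmod (u N t - l t))).
    rewrite !mulr_sumr -big_split; apply: ler_sum => t _ /=.
    have -> : l t = u N t + - (u N t - l t) by rewrite opprB addrC subrK.
    by apply: (le_trans (sqmodD_le _ _)); rewrite sqmodN opprD addNKr opprK.
  by rewrite lerD // ler_wpM2l // ?hM ?hN.
exists (L2 lmem) => eps e0.
have [|N hN] := bnd (eps / 4); first by rewrite divr_gt0.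
exists N => n Nn; apply: (@le_lt_trans _ _ (eps / 2)); last by lra.
apply: hnorm_l2_le => [|s us]; first by rewrite divr_ge0 // ltW.
apply: (le_trans (hN n Nn s us)); rewrite le_eqVlt; apply/orP; left; apply/eqP.
by field.
Qed.

Definition l2_hilbert : hilbertSpace R := Hilbert l2_complete.

End SquareSummable.

(** * Unital completely positive maps into matrices *)

Section Adjoint.
Variable R : realType.

Definition adjmx m n (M : 'M[R[i]]_(m, n)) : 'M[R[i]]_(n, m) := map_mx Num.conj M^T.

Lemma adjmxM m n k (M : 'M_(m, n)) (L : 'M_(n, k)) :
  adjmx (M *m L) = adjmx L *m adjmx M.
Proof. by rewrite /adjmx trmx_mul map_mxM. Qed.

Lemma adjmxK m n (M : 'M_(m, n)) : adjmx (adjmx M) = M.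
Proof. by apply/matrixP => i j; rewrite !mxE conjCK. Qed.

Lemma adjmxD m n (M L : 'M_(m, n)) : adjmx (M + L) = adjmx M + adjmx L.
Proof. by apply/matrixP => i j; rewrite !mxE rmorphD. Qed.

Lemma adjmxZ m n (a : R[i]) (M : 'M_(m, n)) : adjmx (a *: M) = Num.conj a *: adjmx M.
Proof. by apply/matrixP => i j; rewrite !mxE rmorphM. Qed.

Definition sesq m n (M : 'M[R[i]]_(m, n)) (g : 'cV_m) (h : 'cV_n) : R[i] :=
  (adjmx g *m M *m h) 0 0.

Lemma sesqE m n (M : 'M_(m, n)) g h :
  sesq M g h = \sum_i \sum_j Num.conj (g i 0) * M i j * h j 0.
Proof.
rewrite /sesq mxE exchange_big /=; apply: eq_bigr => j _.
by rewrite mxE mulr_suml; apply: eq_bigr => i _; rewrite !mxE.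
Qed.

Lemma sesq1_norm n (h : 'cV[R[i]]_n) : sesq 1%:M h h = (\sum_i sqmod (h i 0))%:C.
Proof.
rewrite /sesq mulmx1 mxE rmorph_sum; apply: eq_bigr => i _.
by rewrite !mxE /= sqmodE mulrC.
Qed.

Lemma sesqMr m n k (M : 'M_(m, n)) (L : 'M_(n, k)) g h :
  sesq (M *m L) g h = sesq M g (L *m h).
Proof. by rewrite /sesq !mulmxA. Qed.

Lemma sesqMl m n k (M : 'M_(k, m)) (L : 'M_(k, n)) g h :
  sesq (adjmx M *m L) g h = sesq L (M *m g) h.
Proof. by rewrite /sesq adjmxM !mulmxA. Qed.

Lemma sesqZ m n (a : R[i]) (M : 'M_(m, n)) g h : sesq (a *: M) g h = a * sesq M g h.
Proof. by rewrite /sesq -scalemxAr -scalemxAl mxE. Qed.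

Lemma sesqZl m n (a : R[i]) (M : 'M_(m, n)) g h :
  sesq M (a *: g) h = Num.conj a * sesq M g h.
Proof. by rewrite /sesq adjmxZ -!scalemxAl mxE. Qed.

Lemma sesqZr m n (a : R[i]) (M : 'M_(m, n)) g h : sesq M g (a *: h) = a * sesq M g h.
Proof. by rewrite /sesq -scalemxAr mxE. Qed.

Lemma sesq_adj m n (M : 'M_(m, n)) g h : sesq (adjmx M) h g = Num.conj (sesq M g h).
Proof.
rewrite !sesqE exchange_big /= rmorph_sum; apply: eq_bigr => i _.
rewrite rmorph_sum; apply: eq_bigr => j _.
by rewrite !mxE !rmorphM /= conjCK mulrC mulrA mulrAC.
Qed.

End Adjoint.

Section UnitalCompletelyPositiveMaps.
Variables (R : realType) (V : lmodType R[i]) (star : V -> V).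
Variables (C : forall n, set 'M[V]_n) (e : V).

Record cpmap k (phi : V -> 'M[R[i]]_k) : Prop := {
  cpmap_linear : linear phi ;
  cpmap_star : forall v, phi (star v) = adjmx (phi v) ;
  cpmap_pos : forall n (x : 'M[V]_n) (h : 'I_n -> 'cV_k), C x ->
    0 <= \sum_i \sum_j sesq (phi (x i j)) (h i) (h j) }.

Record ucp k (phi : V -> 'M[R[i]]_k) : Prop := {
  ucp_cpmap :> cpmap phi ;
  ucp_unit : phi e = 1%:M }.

Lemma cone_herm1 v : operator_system star C e -> C (v%:M : 'M[V]_1) -> star v = v.
Proof.
move=> hV /(mo_herm (os_ordering hV)) /matrixP/(_ 0 0).
by rewrite !mxE eqxx mulr1n.
Qed.

Lemma order_embedding_inj (W : lmodType R[i]) (f : V -> W) : operator_system star C e ->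
  linear f -> (forall v, f v = 0 -> C (v%:M : 'M[V]_1)) -> injective f.
Proof.
move=> hV lin ker v w vw; apply/eqP; rewrite -subr_eq0; apply/eqP.
have vw0 : f (v - w) = 0 by rewrite (linear_funB lin) vw subrr.
have wv0 : f (w - v) = 0 by rewrite (linear_funB lin) vw subrr.
have := os_proper hV (ker _ vw0) _.
rewrite -raddfN opprB => /(_ (ker _ wv0)) /matrixP/(_ 0 0).
by rewrite !mxE eqxx mulr1n.
Qed.

(** With [c = i] and [c = - i] the cone contains [i (x - mxstar star x)] and its negative, so
    properness kills it. It is used where positivity can be tested only on hermitian matrices. *)
Lemma mxstar_fixed n (x : 'M[V]_n) : operator_system star C e ->
  (forall c : R[i], Num.conj c = - c -> C (mxscale c (x - mxstar star x))) ->
  mxstar star x = x.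
Proof.
move=> hV h; have cNi : Num.conj (- 'i : R[i]) = - - 'i by rewrite rmorphN /= conj_i.
apply/esym/eqP; rewrite -subr_eq0; apply/eqP.
have : mxscale 'i (x - mxstar star x) = 0.
  apply: (os_proper hV); first exact: h (conj_i R).
  have := h _ cNi; congr (C _); apply/matrixP => i j; rewrite !mxE.
  exact: scaleNr.
move=> /matrixP h0; apply/matrixP => i j; have := h0 i j; rewrite !mxE => /eqP.
rewrite scaler_eq0 => /orP[|/eqP//].
by rewrite eq_complex /= oner_eq0 andbF.
Qed.

(** The order unit of [C_2] applied to the matrix with corners [- v] and [- star v]. Positivity of
    the result is the substitute for a norm bound on [v]. *)
Lemma off_diagonal_order_unit : operator_system star C e ->
  forall v, exists2 r : R, 0 < r &
    C (\matrix_(i < 2, j < 2) if i == 0 then (if j == 0 then r%:C *: e else v)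
       else (if j == 0 then star v else r%:C *: e)).
Proof.
move=> hV v; have hs := os_star hV.
have s0 : star 0 = 0.
  by have := starZ hs 0 0; rewrite !scale0r rmorph0 scale0r.
have sN w : star (- w) = - star w.
  by have := starZ hs (-1) w; rewrite !scaleN1r rmorphN1 scaleN1r.
pose x : 'M[V]_2 := \matrix_(i < 2, j < 2) if i == 0 then (if j == 0 then 0 else - v)
       else (if j == 0 then - star v else 0).
have [|r r0 Cr] := os_unit hV (x := x).
  apply/matrixP => i j; rewrite !mxE.
  by case: eqP => _; case: eqP => _ //; rewrite ?s0 ?sN ?(starK hs).
exists r => //; move: Cr; congr (C _).
apply/matrixP => i j; rewrite !mxE.
have := ord1; case: (splitP (i : 'I_(1 + 1))) => i' /= iE; case: (splitP (j : 'I_(1 + 1))) => j' /= jE.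
all: rewrite -!(inj_eq val_inj) /= iE jE !ord1 /= ?subr0 ?scaler0 ?sub0r ?opprK //.
Qed.

(** Test the matrix of [off_diagonal_order_unit] on [(- w / r, h)] with [w = phi v h]: the form is
    [r |h|^2 - |w|^2 / r]. The constant depends on [v] alone, so it serves all blocks of a direct
    sum at once. *)
Lemma ucp_bounded : operator_system star C e -> forall v, exists2 r : R, 0 <= r &
  forall k (phi : V -> 'M[R[i]]_k), ucp phi -> forall h : 'cV_k,
    \sum_i sqmod ((phi v *m h) i 0) <= r ^+ 2 * \sum_i sqmod (h i 0).
Proof.
move=> hV v; have [r r0 Cr] := off_diagonal_order_unit hV v.
exists r; first exact: ltW.
move=> k phi hphi h; set w := phi v *m h.
have phiZ := linear_funZ (cpmap_linear hphi).
have := cpmap_pos hphi (fun i : 'I_2 => if i == 0 then (- (r^-1)%:C) *: w else h) Cr.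
rewrite !big_ord_recl !big_ord0 !addr0 !mxE /= (cpmap_star hphi) // !phiZ !(ucp_unit hphi).
set W := \sum_i sqmod (w i 0); set N := \sum_i sqmod (h i 0).
have e2 : sesq (phi v) w h = W%:C.
  by have := sesq1_norm w; rewrite /sesq mulmx1 {3}/w mulmxA.
rewrite sesq_adj !sesqZ !sesqZl !sesqZr e2 !sesq1_norm -rmorphN /= conj_real -!rmorphM /=.
rewrite !conj_real -!rmorphD /= ler0c -/W -/N.
have -> : r * (- r^-1 * (- r^-1 * W)) + - r^-1 * W + (- r^-1 * W + r * N) =
  r * N - r^-1 * W by field; rewrite gt_eqF.
move=> hpos; rewrite expr2 -mulrA -ler_pdivrMl //; move: hpos; lra.
Qed.

End UnitalCompletelyPositiveMaps.

(** * The l2-direct sum of a family of unital completely positive maps *)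

Section DirectSum.
Variables (R : realType) (V : lmodType R[i]) (star : V -> V).
Variables (C : forall n, set 'M[V]_n) (e : V) (hV : operator_system star C e).
Variables (A : eqType) (k : A -> nat) (phi : forall a, V -> 'M[R[i]]_(k a)).
Hypothesis hphi : forall a, ucp star C e (@phi a).

Local Notation T := {a : A & 'I_(k a)}.
Local Notation H := (l2_hilbert R T).

Definition fiber (h : T -> R[i]) a : 'cV[R[i]]_(k a) := \col_i h (Tagged _ i).

Definition fibers (s : seq A) : seq T :=
  [seq Tagged (fun a : A => 'I_(k a)) i | a <- s, i <- enum 'I_(k a)].

Lemma fibers_uniq s : uniq s -> uniq (fibers s).
Proof.
move=> us; apply: allpairs_uniq_dep => //; first by move=> a _; apply: enum_uniq.
by move=> [a i] [b j] _ _.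
Qed.

Lemma mem_fibers s t : tag t \in s -> t \in fibers s.
Proof.
case: t => a i /= sa; apply/allpairsPdep; exists a, i; split=> //.
by rewrite mem_enum.
Qed.

Lemma sum_fibers (Z : nmodType) (u : T -> Z) s :
  \sum_(t <- fibers s) u t = \sum_(a <- s) \sum_(i < k a) u (Tagged _ i).
Proof. by rewrite big_allpairs_dep; apply: eq_bigr => a _; rewrite big_enum. Qed.

Lemma cofinally_fibers (P : seq T -> Prop) :
  (forall s, uniq s -> P (fibers s)) -> cofinally P.
Proof.
move=> h s0; exists (fibers (undup (map tag s0))); split.
- by apply: fibers_uniq; apply: undup_uniq.
- by move=> t ts; apply: mem_fibers; rewrite mem_undup map_f.
- by apply: h; apply: undup_uniq.
Qed.

Definition dsum_fun v (h : T -> R[i]) : T -> R[i] :=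
  fun t => (phi (tag t) v *m fiber h (tag t)) (tagged t) 0.

Lemma fiber_dsum_fun v h a : fiber (dsum_fun v h) a = phi a v *m fiber h a.
Proof. by apply/colP => i; rewrite mxE. Qed.

(** The bound is available block by block, so a finite set of indices is first enlarged to the union
    of the blocks that it meets. *)
Lemma dsum_fun_bound v : exists2 r : R, 0 <= r & forall h s, uniq s ->
  exists2 s', uniq s' &
    \sum_(t <- s) sqmod (dsum_fun v h t) <= r ^+ 2 * \sum_(t <- s') sqmod (h t).
Proof.
have [r r0 hr] := ucp_bounded hV v; exists r => // h s us.
set s' := fibers (undup (map tag s)).
have us' : uniq s' by apply: fibers_uniq; apply: undup_uniq.
exists s' => //; have sub : {subset s <= s'}.
  by move=> t ts; apply: mem_fibers; rewrite mem_undup map_f.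
apply: (@le_trans _ _ (\sum_(t <- s') sqmod (dsum_fun v h t))).
  rewrite (sum_incl _ us' us sub) lerDl sumr_ge0 // => t _; exact: sqmod_ge0.
rewrite !sum_fibers mulr_sumr; apply: ler_sum => a _.
have := hr _ _ (hphi a) (fiber h a); congr (_ <= _ * _).
by apply: eq_bigr => i _; rewrite mxE.
Qed.

Lemma dsum_fun_mem v (h : H) : dsum_fun v h \in @sqsummable_pred R T.
Proof.
have [r r0 hr] := dsum_fun_bound v; have [M hM] := l2_bound h.
apply/asboolP; exists (r ^+ 2 * M) => s us; have [s' us' /le_trans] := hr h s us.
by apply; rewrite ler_wpM2l ?sqr_ge0 // hM.
Qed.

Lemma dsum_fun_linear v (a : R[i]) (g h : H) t :
  dsum_fun v (a *: g + h) t = a * dsum_fun v g t + dsum_fun v h t.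
Proof.
rewrite /dsum_fun; have -> : fiber (a *: g + h) (tag t) =
    a *: fiber g (tag t) + fiber h (tag t).
  by apply/colP => i; rewrite !mxE.
by rewrite mulmxDr -scalemxAr !mxE.
Qed.

Lemma dsum_op_bounded v :
  (fun h : H => L2 (dsum_fun_mem v h) : H) \in @bounded_operator_pred R H.
Proof.
apply/asboolP; split=> [a g h|].
  by apply: l2E => t; rewrite l2_linE; exact: dsum_fun_linear.
have [r r0 hr] := dsum_fun_bound v; exists r => h.
apply: hnorm_l2_le => [|s us]; first by rewrite mulr_ge0 // sqrtr_ge0.
have [s' us' /le_trans] := hr h s us; apply.
by rewrite exprMn ler_wpM2l ?sqr_ge0 // sqr_hnorm_l2.
Qed.

Definition dsum_op v : boundedOperator H := BoundedOperator (dsum_op_bounded v).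

Lemma bopE (f g : boundedOperator H) : (forall h, f h = g h) -> f = g.
Proof. by move=> fg; apply: val_inj; apply: funext. Qed.

Lemma dsum_op_linear : linear dsum_op.
Proof.
move=> a v w; apply: bopE => h; apply: l2E => t.
rewrite /dsum_op /= /dsum_fun (cpmap_linear (hphi _)) mulmxDl -scalemxAl mxE [X in X + _]mxE.
by [].
Qed.

Lemma sum_fibers_sesq v (g h : T -> R[i]) s :
  \sum_(t <- fibers s) dsum_fun v g t * Num.conj (h t) =
  \sum_(a <- s) sesq (phi a v) (fiber h a) (fiber g a).
Proof.
rewrite sum_fibers; apply: eq_bigr => a _.
rewrite /sesq -mulmxA mxE; apply: eq_bigr => i _.
by rewrite mulrC; congr (_ * _); rewrite !mxE.
Qed.

Lemma dsum_op_sums n (x : 'M[V]_n) (h : 'I_n -> H) :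
  sums_to (fun t => \sum_i \sum_j dsum_fun (x i j) (h j) t * Num.conj (h i t))
   (\sum_i \sum_j hdot H (map_mx dsum_op x i j (h j)) (h i)).
Proof.
apply: sums_to_sum => i; apply: sums_to_sum => j; 
have -> : map_mx dsum_op x i j = dsum_op (x i j) by rewrite mxE.
exact: (@l2dotP R T (dsum_op (x i j) (h j)) (h i)).
Qed.

Lemma dsum_op_sum_fibers n (x : 'M[V]_n) (h : 'I_n -> H) s :
  \sum_(t <- fibers s) \sum_i \sum_j dsum_fun (x i j) (h j) t * Num.conj (h i t) =
  \sum_(a <- s) \sum_i \sum_j sesq (phi a (x i j)) (fiber (h i) a) (fiber (h j) a).
Proof.
rewrite exchange_big [RHS]exchange_big; apply: eq_bigr => i _ /=.
rewrite exchange_big [RHS]exchange_big; apply: eq_bigr => j _ /=.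
exact: sum_fibers_sesq.
Qed.

Lemma dsum_op_cp : completely_positive C (@bop_cone R H) dsum_op.
Proof.
move=> n x Cx h; apply: sums_to_ge0 (dsum_op_sums x h) _.
apply: cofinally_fibers => s us; rewrite dsum_op_sum_fibers.
by apply: sumr_ge0 => a _; apply: (cpmap_pos (hphi a)).
Qed.

(** Extension by zero from the block [a]; the cast is there because the block size depends on the
    tag. *)
Definition fiber_inj a (g : 'cV[R[i]]_(k a)) : T -> R[i] :=
  fun t => match @eqP _ (tag t) a with
    | ReflectT ta => g (cast_ord (congr1 k ta) (tagged t)) 0
    | ReflectF _ => 0
    end.

Lemma fiber_injK a g : fiber (@fiber_inj a g) a = g.
Proof.
apply/colP => i; rewrite mxE /fiber_inj /=; case: eqP => // ta.
by congr (g _ _); apply: val_inj.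
Qed.

Lemma fiber_inj_out a g b : b != a -> fiber (@fiber_inj a g) b = 0.
Proof.
move=> ba; apply/colP => i; rewrite !mxE /fiber_inj /=; case: eqP => // ta.
by rewrite ta eqxx in ba.
Qed.

Lemma fiber_inj_mem a g : @fiber_inj a g \in @sqsummable_pred R T.
Proof.
apply/asboolP; exists (\sum_i sqmod (g i 0)) => s us.
set s' := fibers (undup (a :: map tag s)).
have us' : uniq s' by apply: fibers_uniq; apply: undup_uniq.
have sub : {subset s <= s'}.
  by move=> t ts; apply: mem_fibers; rewrite mem_undup inE map_f ?orbT.
apply: (@le_trans _ _ (\sum_(t <- s') sqmod (fiber_inj g t))).
  rewrite (sum_incl _ us' us sub) lerDl sumr_ge0 // => t _; exact: sqmod_ge0.
rewrite sum_fibers (bigD1_seq a) ?undup_uniq ?mem_undup ?inE ?eqxx //=.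
rewrite [X in _ + X]big1 ?addr0 => [|b ba].
  by apply/ler_sum => i _; have /colP/(_ i) := fiber_injK g; rewrite mxE => ->.
apply: big1 => i _; have /colP/(_ i) := fiber_inj_out g ba; rewrite !mxE => ->.
by rewrite /sqmod /= expr0n addr0.
Qed.

(** Vectors supported in the single block [a] isolate the form of [phi a]. *)
Lemma dsum_op_separates n (x : 'M[V]_n) : bop_cone (map_mx dsum_op x) ->
  forall a (g : 'I_n -> 'cV[R[i]]_(k a)),
    0 <= \sum_i \sum_j sesq (phi a (x i j)) (g i) (g j).
Proof.
move=> bx a g; pose h i : H := L2 (fiber_inj_mem (g i)).
have := bx h; congr (_ <= _).
have fin : sums_to (fun t => \sum_i \sum_j dsum_fun (x i j) (h j) t * Num.conj (h i t))
    (\sum_(t <- fibers [:: a]) \sum_i \sum_j dsum_fun (x i j) (h j) t * Num.conj (h i t)).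
  apply: sums_to_finite => [|t ta]; first exact: fibers_uniq.
  have ta' : tag t != a by apply: contraNneq ta => <-; apply: mem_fibers; rewrite inE.
  apply: big1 => i _; apply: big1 => j _.
  by rewrite /dsum_fun fiber_inj_out // mulmx0 mxE mul0r.
rewrite (sums_to_unique (dsum_op_sums x h) fin) dsum_op_sum_fibers big_seq1.
by apply: eq_bigr => i _; apply: eq_bigr => j _; rewrite !fiber_injK.
Qed.

Lemma dsum_op_unit h : dsum_op e h = h.
Proof.
by apply: l2E => t; rewrite /= /dsum_fun (ucp_unit (hphi _)) mul1mx mxE; case: t.
Qed.

Lemma dsum_op_projection p : star p = p ->
  (forall a, phi a p *m phi a p = phi a p) -> is_projection (dsum_op p).
Proof.
move=> sp idp; split=> [h|g h].
  by apply: l2E => t; rewrite /= /dsum_fun fiber_dsum_fun mulmxA idp.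
change (l2dot (dsum_op p g) h = l2dot g (dsum_op p h)); rewrite [RHS]l2dotC.
(* Both inner products are limits along unions of whole blocks, where [cpmap_star] and [star p = p]
   make each [phi a p] hermitian. *)
apply: eq_sums_to_cofinal (l2dotP _ _) (sums_to_conj (l2dotP _ _)) _.
apply: cofinally_fibers => s us; rewrite -rmorph_sum /= !sum_fibers_sesq rmorph_sum.
by apply: eq_bigr => a _ /=; rewrite -sesq_adj -(cpmap_star (hphi a)) sp.
Qed.

Lemma dsum_abstract_projection p : positive_contraction C e p -> star p = p ->
    (forall a, phi a p *m phi a p = phi a p) ->
    (forall n (x : 'M[V]_n), (forall a (g : 'I_n -> 'cV[R[i]]_(k a)),
       0 <= \sum_i \sum_j sesq (phi a (x i j)) (g i) (g j)) -> C x) ->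
  abstract_projection C e p.
Proof.
move=> cp sp idp sep; split=> //; exists H, dsum_op; split.
- have inv n (x : 'M[V]_n) : bop_cone (map_mx dsum_op x) -> C x.
    by move=> bx; apply: sep; apply: dsum_op_separates.
  split=> //; [exact: dsum_op_linear| |exact: dsum_op_cp].
  apply: (order_embedding_inj hV dsum_op_linear) => v v0; apply: inv => h.
  rewrite !big_ord_recl !big_ord0 !mxE eqxx mulr1n v0.
  by change (0 <= l2dot (0 : l2 R T) (h ord0) + 0 + 0); rewrite l2dot0l !addr0 lexx.
- exact: dsum_op_unit.
- exact: dsum_op_projection.
Qed.

End DirectSum.

(** If [W > 0], the choice [s = W / (c + 1)] violates the inequality; the [+ 1] allows [c = 0]. *)
Lemma quadratic_bound_eq0 (R : realType) (W c : R) : 0 <= W -> 0 <= c ->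
  (forall s : R, 0 < s -> 2 * (s * W) <= s ^+ 2 * c) -> W = 0.
Proof.
move=> W0 c0 h; apply/eqP; rewrite eq_le W0 andbT leNgt; apply/negP => Wgt.
have c1 : 0 < c + 1 by lra.
have := h (W / (c + 1)) (divr_gt0 Wgt c1); rewrite leNgt => /negP; apply.
have -> : (W / (c + 1)) ^+ 2 * c = W / (c + 1) * W * (c / (c + 1)).
  by field; rewrite gt_eqF.
have : c / (c + 1) < 1 by rewrite ltr_pdivrMr //; lra.
have : 0 < W / (c + 1) * W by rewrite mulr_gt0 // divr_gt0.
set a := W / (c + 1) * W; set b := c / (c + 1); nra.
Qed.

(** * Kernels and normalization of positive semidefinite matrices *)

Section PositiveSemidefinite.
Variable R : realType.

Lemma sesqD m n (M : 'M[R[i]]_(m, n)) g g' h h' :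
  sesq M (g + g') (h + h') = sesq M g h + sesq M g h' + (sesq M g' h + sesq M g' h').
Proof. by rewrite /sesq adjmxD !mulmxDl !mulmxDr mxE [X in X + _]mxE [X in _ + X]mxE. Qed.

Lemma mulmx_cVP m n (M L : 'M[R[i]]_(m, n)) : (forall u : 'cV_n, M *m u = L *m u) -> M = L.
Proof.
move=> ML; apply/matrixP => i j; have /colP/(_ i) := ML (delta_mx j 0).
by rewrite -!colE !mxE.
Qed.

(** Positivity at [h - s w] with [w = M h] reads [2 s |w|^2 <= s^2 c], where [c] is the form at [w];
    letting [s] be small forces [w = 0]. *)
Lemma psd_ker n (M : 'M[R[i]]_n) (h : 'cV_n) : adjmx M = M ->
  (forall g, 0 <= sesq M g g) -> sesq M h h = 0 -> M *m h = 0.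
Proof.
move=> Mh Mpos h0; set w := M *m h; pose W := \sum_i sqmod (w i 0).
have wW : sesq M w h = W%:C.
  by have := sesq1_norm w; rewrite /sesq mulmx1 -/W {3}/w mulmxA.
have hw : sesq M h w = W%:C.
  by rewrite -[M]Mh sesq_adj wW conj_real.
have W0 : 0 <= W by apply: sumr_ge0 => i _; apply: sqmod_ge0.
have [c cE] := RtoC_ge0P (Mpos w).
have c0 : 0 <= c by have := Mpos w; rewrite cE ler0c.
have W00 : W = 0.
  apply: (quadratic_bound_eq0 W0 c0) => s s0.
  have := Mpos (h + (- s)%:C *: w).
  rewrite sesqD h0 !sesqZl !sesqZr wW hw cE add0r.
  rewrite conj_real.
  rewrite -!rmorphM -!rmorphD /= ler0c; lra.
apply/colP => i; rewrite [RHS]mxE; apply: sqmod_eq0; apply/eqP.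
move: W00 => /eqP; rewrite psumr_eq0 => [/allP/(_ i)|j _]; last exact: sqmod_ge0.
by rewrite mem_index_enum => /(_ isT) /implyP/(_ isT).
Qed.

(** [B] stands for the inverse square root of [M] on its range: the columns of [B] are orthonormal
    for the form of [M]. The rank bounds the length of such systems, and a system of maximal length
    gives the factorization of [M]. *)
Lemma psd_compression n (M : 'M[R[i]]_n) : adjmx M = M -> (forall g, 0 <= sesq M g g) ->
  exists r (B : 'M_(n, r)), adjmx B *m M *m B = 1%:M /\ M = M *m B *m (adjmx B *m M).
Proof.
move=> Mh Mpos; pose P r := `[< exists B : 'M_(n, r), adjmx B *m M *m B = 1%:M >].
have P0 : exists r, P r.
  by exists 0%N; apply/asboolP; exists 0; apply/matrixP => -[].
have Pn r : P r -> (r <= n)%N.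
  move=> /asboolP[B B1]; rewrite -(mxrank1 [the fieldType of R[i]] r) -B1.
  exact: leq_trans (mxrankM_maxr _ _) (rank_leq_row _).
case: (ex_maxnP P0 Pn) => r /asboolP[B B1] max; exists r, B; split=> //.
suff ker (u : 'cV_n) : M *m (u - B *m (adjmx B *m M *m u)) = 0.
  apply: mulmx_cVP => u; apply/eqP; rewrite -subr_eq0 -!mulmxA -mulmxBr.
  by have := ker u; rewrite -!mulmxA => ->.
set w := u - _.
have Bw : adjmx B *m M *m w = 0 by rewrite mulmxBr !mulmxA B1 mul1mx -!mulmxA subrr.
(* If the form at [w] were [q > 0], the column [w / s] with [s * s = q] could be appended to [B],
   [Bw] being its orthogonality to the other columns. *)
apply: psd_ker => //; apply/eqP; apply/negPn/negP => q0.
have qgt : 0 < sesq M w w by rewrite lt0r q0 Mpos.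
have [q qE] := RtoC_ge0P (Mpos w).
have {qgt} q1 : 0 < q by move: qgt; rewrite qE ltcR.
have [s s0 sE] : exists2 s : R, s != 0 & s * s = q.
  by exists (Num.sqrt q); rewrite -?expr2 ?sqr_sqrtr ?gt_eqF ?sqrtr_gt0 // ltW.
pose c : R[i] := (s^-1)%:C.
have cc : Num.conj c = c by apply: conj_real.
have cq : c * (c * q%:C) = 1.
  by rewrite -sE -!rmorphM /= mulKf // mulVf.
suff Pr1 : P (r + 1)%N by have := max _ Pr1; rewrite addn1 ltnn.
apply/asboolP; exists (row_mx B (c *: w)).
have -> : adjmx (row_mx B (c *: w)) = col_mx (adjmx B) (c *: adjmx w).
  by rewrite /adjmx tr_row_mx map_col_mx -/(adjmx (c *: w)) adjmxZ cc.
rewrite mul_col_mx mul_col_row B1 -!scalemxAr Bw scaler0.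
have -> : c *: adjmx w *m M *m B = 0.
  rewrite -!scalemxAl -[X in _ *m X *m _]Mh -adjmxM.
  rewrite -[B]adjmxK -adjmxM mulmxA Bw.
  by apply/matrixP => i j; rewrite !mxE rmorph0 mulr0.
have -> : c *: (c *: adjmx w *m M *m w) = 1%:M.
  apply/matrixP => i j; rewrite !ord1 -!scalemxAl mxE [X in _ * X]mxE.
  by rewrite -/(sesq M w w) qE cq !mxE.
by rewrite -scalar_mx_block.
Qed.

End PositiveSemidefinite.

(** * Making a completely positive map unital *)

Section Normalization.
Variables (R : realType) (V : lmodType R[i]) (star : V -> V).
Variables (C : forall n, set 'M[V]_n) (e : V) (hV : operator_system star C e).

Variables (k : nat) (psi : V -> 'M[R[i]]_k) (hpsi : cpmap star C psi).

Lemma os_unit_pos : C (e%:M : 'M[V]_1).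
Proof.
have [|r r0] := os_unit hV (x := 0 : 'M[V]_1).
  apply/matrixP => i j; rewrite !mxE.
  by have := starZ (os_star hV) 0 0; rewrite !scale0r rmorph0 scale0r.
rewrite subr0 => /(moZ (os_ordering hV) (r := r^-1)).
rewrite invr_ge0 ltW // => /(_ isT); congr (C _); apply/matrixP => i j.
by rewrite !mxE scalerA -rmorphM /= mulVf ?scale1r // gt_eqF.
Qed.

Lemma cpmap_psd v (g : 'cV_k) : C (v%:M : 'M[V]_1) -> 0 <= sesq (psi v) g g.
Proof.
move=> Cv; have := cpmap_pos hpsi (fun=> g) Cv.
by rewrite !big_ord_recl !big_ord0 !addr0 !mxE eqxx mulr1n.
Qed.

Lemma cpmap_unit_herm : adjmx (psi e) = psi e.
Proof. by rewrite -(cpmap_star hpsi) (os_unit_herm hV). Qed.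

(** The off-diagonal positive matrix tested on [(- s w, h)] with [w = psi v h] leaves
    [2 s |w|^2 <= s^2 r c], because [psi e] annihilates [h]. *)
Lemma cpmap_unit_ker v (h : 'cV_k) : psi e *m h = 0 -> psi v *m h = 0.
Proof.
move=> h0; have [r r0 Cr] := off_diagonal_order_unit hV v.
set w := psi v *m h; pose W := \sum_i sqmod (w i 0).
have W0 : 0 <= W by apply: sumr_ge0 => i _; apply: sqmod_ge0.
have wW : sesq (psi v) w h = W%:C.
  by have := sesq1_norm w; rewrite /sesq mulmx1 -/W {3}/w mulmxA.
have eh g : sesq (psi e) g h = 0 by rewrite /sesq -mulmxA h0 mulmx0 mxE.
have cw := cpmap_psd w os_unit_pos.
have [c cE] := RtoC_ge0P cw.
have c0 : 0 <= c by move: cw; rewrite cE ler0c.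
have W00 : W = 0.
  apply: (@quadratic_bound_eq0 _ _ (r * c)) => //; first by rewrite mulr_ge0 // ltW.
  move=> s s0.
  have := cpmap_pos hpsi (fun i : 'I_2 => if i == 0 then (- s)%:C *: w else h) Cr.
  rewrite !big_ord_recl !big_ord0 !addr0 !mxE /= (cpmap_star hpsi) // !(linear_funZ (cpmap_linear hpsi)).
  rewrite sesq_adj !sesqZ !sesqZl !sesqZr wW cE eh mulr0 addr0.
  rewrite !conj_real -!rmorphM /= conj_real -!rmorphD /= ler0c; lra.
apply/colP => i; rewrite [RHS]mxE; apply: sqmod_eq0; apply/eqP.
move: W00 => /eqP; rewrite psumr_eq0 => [/allP/(_ i)|j _]; last exact: sqmod_ge0.
by rewrite mem_index_enum => /(_ isT) /implyP/(_ isT).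
Qed.

(** [phi v = B^* psi v B], and [D = B^* psi e] undoes the compression: [u - B D u] is in the kernel
    of [psi e], hence of [psi v], so [psi v = D^* phi v D]. Negative values of a form of [psi] are
    thus kept by [phi]. Idempotence follows by collapsing [psi e B B^* psi e] to [psi e] between two
    factors [E]. *)
Lemma cpmap_normalize : exists r (phi : V -> 'M[R[i]]_r) (D : 'M_(r, k)),
  [/\ ucp star C e phi,
      forall v (g h : 'cV_k), sesq (psi v) g h = sesq (phi v) (D *m g) (D *m h)
    & forall p E, E *m E = E -> psi p = E *m psi e -> psi p = psi e *m E ->
        phi p *m phi p = phi p].
Proof.
have Ah := cpmap_unit_herm; have Apos g := cpmap_psd g os_unit_pos.
have [r [B [B1 AB]]] := psd_compression Ah Apos.
pose D := adjmx B *m psi e.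
have DE : adjmx D = psi e *m B by rewrite adjmxM adjmxK Ah.
have psiD v : psi v = psi v *m B *m D.
  apply: mulmx_cVP => u; apply/eqP; rewrite -subr_eq0 -!mulmxA -mulmxBr; apply/eqP.
  apply: cpmap_unit_ker; rewrite mulmxBr !mulmxA -[psi e *m B *m adjmx B *m _]mulmxA.
  by rewrite -AB subrr.
have Dpsi v : psi v = adjmx D *m (adjmx B *m psi v).
  have := psiD (star v); rewrite (cpmap_star hpsi) => /(congr1 (@adjmx R _ _)).
  by rewrite adjmxK (adjmxM (adjmx (psi v) *m B)) (adjmxM _ B) adjmxK.
exists r, (fun v => adjmx B *m psi v *m B), D; split.
- split; last exact: B1.
  split.
  + by move=> a u v; rewrite (cpmap_linear hpsi) mulmxDr mulmxDl -scalemxAr -scalemxAl.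
  + by move=> v; rewrite (cpmap_star hpsi) !adjmxM adjmxK mulmxA.
  + move=> n x h Cx; have := cpmap_pos hpsi (fun i => B *m h i) Cx; congr (_ <= _).
    by apply: eq_bigr => i _; apply: eq_bigr => j _; rewrite -mulmxA sesqMl sesqMr.
- move=> v g h; rewrite -sesqMr -sesqMl; congr sesq.
  by rewrite -!mulmxA [psi v *m _]mulmxA -psiD -Dpsi.
- move=> p E EE pE Ep /=.
  transitivity (adjmx B *m (E *m (psi e *m B *m (adjmx B *m psi e)) *m E) *m B).
    by rewrite {1}pE Ep !mulmxA.
  by rewrite -AB -pE Ep -[psi e *m E *m E]mulmxA EE.
Qed.

End Normalization.

(** * Perturbation cones *)

Section MatrixOrderings.
Variables (R : realType) (V : lmodType R[i]) (star : V -> V).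
Variables (C : forall n, set 'M[V]_n) (e : V) (hV : operator_system star C e).

Let mo : matrix_ordering star C := os_ordering hV.
Let hs : is_star star := os_star hV.

Lemma star0 : star 0 = 0.
Proof. by have := starZ hs 0 0; rewrite !scale0r rmorph0 scale0r. Qed.

Lemma starN v : star (- v) = - star v.
Proof. by have := starZ hs (-1) v; rewrite !scaleN1r rmorphN1 scaleN1r. Qed.

Lemma star_sum I r (P : pred I) (F : I -> V) :
  star (\sum_(i <- r | P i) F i) = \sum_(i <- r | P i) star (F i).
Proof. by elim/big_ind2: _ => [|x u y v <- <-|]; rewrite ?star0 ?(starD hs). Qed.

Lemma cone_sum n I r (P : pred I) (F : I -> 'M[V]_n) :
  (forall i, P i -> C (F i)) -> C (\sum_(i <- r | P i) F i).
Proof. by move=> h; apply: big_ind => //; [exact: (mo0 mo)|exact: (moD mo)]. Qed.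

Lemma cone_scale n (r : R) (x : 'M[V]_n) : 0 <= r -> C x -> C (mxscale r%:C x).
Proof. exact: (moZ mo). Qed.

Lemma cone_add n (x y : 'M[V]_n) : C x -> C y -> C (x + y).
Proof. exact: (moD mo). Qed.

Lemma cone_scaleK n (r : R) (x : 'M[V]_n) : 0 < r -> C (mxscale r%:C x) -> C x.
Proof.
move=> r0 /(cone_scale (r := r^-1)); rewrite invr_ge0 ltW // => /(_ isT).
congr (C _); apply/matrixP => i j.
by rewrite !mxE scalerA -rmorphM /= mulVf ?gt_eqF // scale1r.
Qed.

(** Compression by the matrix whose row [i] has the single entry [c i], in column [u i]. *)
Definition pull d m (c : 'I_d -> R[i]) (u : 'I_d -> 'I_m) (x : 'M[V]_m) : 'M[V]_d :=
  \matrix_(i, j) ((c i * Num.conj (c j)) *: x (u i) (u j)).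

Lemma cone_pull d m c (u : 'I_d -> 'I_m) x : C x -> C (pull c u x).
Proof.
move=> /(mo_compress mo (\matrix_(i, k) if k == u i then c i else 0)).
congr (C _); apply/matrixP => i j; rewrite !mxE.
rewrite (bigD1 (u i)) //= [X in _ + X]big1 ?addr0 => [|k /negPf ki]; last first.
  by apply: big1 => l _; rewrite !mxE ki mul0r scale0r.
rewrite (bigD1 (u j)) //= [X in _ + X]big1 ?addr0 => [|k /negPf ki]; last first.
  by rewrite !mxE ki rmorph0 mulr0 scale0r.
by rewrite !mxE !eqxx.
Qed.

Lemma pullD d m c (u : 'I_d -> 'I_m) x y : pull c u (x + y) = pull c u x + pull c u y.
Proof. by apply/matrixP => i j; rewrite !mxE scalerDr. Qed.

Definition sqnorm n (w : 'I_n -> R[i]) : R := \sum_i sqmod (w i).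

(** The pattern [nu i == nu j] is the sum over [k] of the rank one patterns of the classes of [nu],
    and each of these comes from a compression of [x]. *)
Lemma cone_block_diag d m n (nu : 'I_d -> 'I_n) (u : 'I_d -> 'I_m) (x : 'M[V]_m) :
  C x -> C (\matrix_(i, j) ((nu i == nu j)%:R *: x (u i) (u j))).
Proof.
move=> Cx; have := cone_sum (index_enum 'I_n) (P := predT)
  (fun k _ => cone_pull (fun i => (nu i == k)%:R) u Cx).
congr (C _); apply/matrixP => i j; rewrite summxE mxE.
rewrite (bigD1 (nu i)) //= big1 => [|k /negPf ki]; last first.
  by rewrite mxE [nu i == k]eq_sym ki mul0r scale0r.
by rewrite mxE eqxx mul1r rmorph_nat addr0 eq_sym.
Qed.

(* Lagrange's identity exhibits [|w|^2 I - w w^*] as a sum of rank one positives. *)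
Lemma cone_lagrange d m n (nu : 'I_d -> 'I_n) (u : 'I_d -> 'I_m)
    (w : 'I_n -> R[i]) (x : 'M[V]_m) : C x ->
  C (\matrix_(i, j) (((nu i == nu j)%:R * (sqnorm w)%:C - w (nu i) * Num.conj (w (nu j)))
       *: x (u i) (u j))).
Proof.
move=> Cx; apply: (@cone_scaleK _ 2) => //.
(* The vectors [conj w_l e_k - conj w_k e_l]. The sum runs over ordered pairs, which produces the
   factor [2]. *)
pose c k l i : R[i] := (nu i == k)%:R * Num.conj (w l) - (nu i == l)%:R * Num.conj (w k).
have := cone_sum (index_enum 'I_n) (P := predT) (fun k _ =>
  cone_sum (index_enum 'I_n) (P := predT) (fun l _ => cone_pull (c k l) u Cx)).
congr (C _); apply/matrixP => i j; rewrite summxE.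
under eq_bigr => k _ do (rewrite summxE; under eq_bigr => l _ do rewrite mxE).
under eq_bigr => k _ do rewrite -scaler_suml.
rewrite -scaler_suml !mxE scalerA; congr (_ *: _).
have sel (a : 'I_n) (F : 'I_n -> R[i]) : \sum_k (a == k)%:R * F k = F a.
  rewrite (bigD1 a) //= big1 ?eqxx ?mul1r ?addr0 // => k /negPf ka.
  by rewrite eq_sym ka mul0r.
have cE k l : c k l i * Num.conj (c k l j) =
    (nu i == k)%:R * ((nu j == k)%:R * (w l * Num.conj (w l)))
    - (nu i == k)%:R * ((nu j == l)%:R * (w k * Num.conj (w l)))
    - (nu j == k)%:R * ((nu i == l)%:R * (w l * Num.conj (w k)))
    + (nu i == l)%:R * ((nu j == l)%:R * (w k * Num.conj (w k))).
  rewrite /c rmorphB !rmorphM /= !rmorph_nat !conjCK; ring.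
under eq_bigr => k _ do (under eq_bigr => l _ do rewrite cE).
have wwE : \sum_l w l * Num.conj (w l) = (sqnorm w)%:C.
  by rewrite /sqnorm rmorph_sum; apply: eq_bigr => l _; rewrite /= sqmodE.
have inner k : \sum_l ((nu i == k)%:R * ((nu j == k)%:R * (w l * Num.conj (w l)))
    - (nu i == k)%:R * ((nu j == l)%:R * (w k * Num.conj (w l)))
    - (nu j == k)%:R * ((nu i == l)%:R * (w l * Num.conj (w k)))
    + (nu i == l)%:R * ((nu j == l)%:R * (w k * Num.conj (w k)))) =
    (nu i == k)%:R * ((nu j == k)%:R * (sqnorm w)%:C)
    - (nu i == k)%:R * (w k * Num.conj (w (nu j)))
    - (nu j == k)%:R * (w (nu i) * Num.conj (w k))
    + (nu j == nu i)%:R * (w k * Num.conj (w k)).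
  by rewrite big_split !sumrB /= -!mulr_sumr wwE !sel.
rewrite (eq_bigr _ (fun k _ => inner k)) big_split !sumrB /= -mulr_sumr wwE !sel.
rewrite [nu j == _]eq_sym; set a := _%:R; ring.
Qed.

End MatrixOrderings.

Section PerturbationCones.
Variables (R : realType) (V : lmodType R[i]) (star : V -> V).
Variables (C : forall n, set 'M[V]_n) (e : V) (hV : operator_system star C e).
Variables (m N : nat) (P Q : 'I_N -> 'M[V]_m).
Hypothesis hP : forall k, C (P k).
Hypothesis hQ : forall k, C (Q k).

Let mo : matrix_ordering star C := os_ordering hV.

Definition ksum n (a : 'I_N -> R) (S : 'I_N -> 'M[V]_m) : 'M[V]_(n * m) :=
  \sum_k mxscale (a k)%:C (kronl (1%:M : 'M_n) (S k)).

Definition pert n (x : 'M[V]_(n * m)) (eps t : 'I_N -> R) : Prop :=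
  C (x + ksum n eps P + ksum n t Q).

(** Common form of [Cproj], with one index, and [Cprojs], so that the quotient argument is made
    once. *)
Definition pcone n : set 'M[V]_(n * m) :=
  [set x | mxstar star x = x /\
     forall eps : 'I_N -> R, (forall k, 0 < eps k) ->
       exists t : 'I_N -> R,
         [/\ forall k, 0 < t k, pert x eps t
           & forall i (eps' : R), 0 < eps' < eps i ->
               exists2 t' : R, t i < t' &
                 pert x [eta eps with i |-> eps'] [eta t with i |-> t']]].

Lemma ksumD n a b S : ksum n (fun k => a k + b k) S = ksum n a S + ksum n b S.
Proof.
rewrite /ksum -big_split; apply: eq_bigr => k _ /=; apply/matrixP => i j.
by rewrite !mxE rmorphD scalerDl.
Qed.

Lemma ksumZ n (r : R) a S : ksum n (fun k => r * a k) S = mxscale r%:C (ksum n a S).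
Proof.
apply/matrixP => i j; rewrite /ksum mxE !summxE scaler_sumr; apply: eq_bigr => k _.
by rewrite !mxE rmorphM -scalerA.
Qed.

Lemma cone_kron n x : C (x : 'M[V]_m) -> C (kronl (1%:M : 'M_n) x).
Proof.
move=> /(cone_block_diag hV (fun i : 'I_(n * m) => (mxtens_unindex i).1)
  (fun i : 'I_(n * m) => (mxtens_unindex i).2)).
by congr (C _); apply/matrixP => i j; rewrite !mxE.
Qed.

Lemma cone_ksum n a S : (forall k, C (S k)) -> (forall k, 0 <= a k) -> C (ksum n a S).
Proof.
by move=> hS a0; apply: (cone_sum hV) => k _; apply: (cone_scale hV) => //; apply: cone_kron.
Qed.

Lemma ksum_mono n x a b S : (forall k, C (S k)) -> (forall k, a k <= b k) ->
  C (x + ksum n a S) -> C (x + ksum n b S).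
Proof.
move=> hS ab Cx; have -> : b = fun k => a k + (b k - a k).
  by apply: funext => k; rewrite addrC subrK.
rewrite ksumD addrA; apply: (cone_add hV) => //.
by apply: cone_ksum => // k; rewrite subr_ge0.
Qed.

Lemma pert_mono n (x : 'M[V]_(n * m)) eps eps' t t' : (forall k, eps k <= eps' k) ->
  (forall k, t k <= t' k) -> pert x eps t -> pert x eps' t'.
Proof.
rewrite /pert => h h' Cx; apply: ksum_mono h' _ => //; rewrite addrAC.
by apply: ksum_mono h _ => //; rewrite addrAC.
Qed.

Lemma pert_add n (x y : 'M[V]_(n * m)) a b s t : pert x a s -> pert y b t ->
  pert (x + y) (fun k => a k + b k) (fun k => s k + t k).
Proof.
move=> Cx Cy; rewrite /pert !ksumD; have := cone_add hV Cx Cy; congr (C _).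
by rewrite addrACA [X in X + _]addrACA.
Qed.

Lemma pert_scale n (r : R) (x : 'M[V]_(n * m)) a t : 0 <= r -> pert x a t ->
  pert (mxscale r%:C x) (fun k => r * a k) (fun k => r * t k).
Proof.
move=> r0 Cx; rewrite /pert !ksumZ; have := cone_scale hV r0 Cx; congr (C _).
by apply/matrixP => i j; rewrite !mxE !scalerDr.
Qed.

Lemma pcone_sub n (x : 'M[V]_(n * m)) : C x -> pcone x.
Proof.
move=> Cx; split; first exact: (mo_herm mo).
have xP eps t : (forall k, 0 <= eps k) -> (forall k, 0 <= t k) -> pert x eps t.
  by move=> e0 t0; do 2?[apply: (cone_add hV)] => //; exact: cone_ksum.
move=> eps e0; exists (fun=> 1); split=> //.
  by apply: xP => // k; apply: ltW.
move=> i eps' /andP[e'0 _]; exists 2; first by rewrite ltr1n.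
by apply: xP => k /=; case: ifP => _ //; apply: ltW.
Qed.

Lemma pcone_add n (x y : 'M[V]_(n * m)) : pcone x -> pcone y -> pcone (x + y).
Proof.
move=> [xh hx] [yh hy]; split.
  rewrite -[in RHS]xh -[in RHS]yh; apply/matrixP => i j; rewrite !mxE.
  exact: (starD (os_star hV)).
move=> eps e0; have e2 k : 0 < eps k / 2 by rewrite divr_gt0.
have [s [s0 xs hs]] := hx _ e2; have [t [t0 yt ht]] := hy _ e2.
exists (fun k => s k + t k); split=> [k||i eps' /andP[e'0 e'lt]].
- exact: addr_gt0.
- by apply: pert_mono (pert_add xs yt) => // k; rewrite -splitr.
have e'2 : 0 < eps' / 2 < eps i / 2 by rewrite divr_gt0 //= ltr_pM2r ?invr_gt0.
have [s' ss' xs'] := hs i _ e'2; have [t' tt' yt'] := ht i _ e'2.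
exists (s' + t'); first exact: ltrD.
by apply: pert_mono (pert_add xs' yt') => k /=; case: ifP => _ //; rewrite -splitr.
Qed.

Lemma pcone_scale n (r : R) (x : 'M[V]_(n * m)) : 0 < r -> pcone x ->
  pcone (mxscale r%:C x).
Proof.
move=> r0 [xh hx]; split.
  rewrite -[in RHS]xh; apply/matrixP => i j; rewrite !mxE.
  by rewrite (starZ (os_star hV)) conj_real.
move=> eps e0; have er k : 0 < eps k / r by rewrite divr_gt0.
have rK a : r * (a / r) = a by rewrite mulrC divfK ?gt_eqF.
have [t [t0 xt ht]] := hx _ er.
exists (fun k => r * t k); split=> [k||i eps' /andP[e'0 e'lt]].
- exact: mulr_gt0.
- by apply: pert_mono (pert_scale (ltW r0) xt) => // k; rewrite rK.
have e'2 : 0 < eps' / r < eps i / r by rewrite divr_gt0 //= ltr_pM2r ?invr_gt0.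
have [t' tt' xt'] := ht i _ e'2; exists (r * t'); first by rewrite ltr_pM2l.
by apply: pert_mono (pert_scale (ltW r0) xt') => k /=; case: ifP => _ //; rewrite rK.
Qed.

(** This is [w w^* (x) y]. *)
Definition lift_vec n (w : 'I_n -> R[i]) (y : 'M[V]_(1 * m)) : 'M[V]_(n * m) :=
  pull (fun i : 'I_(n * m) => w (mxtens_unindex i).1)
       (fun i => mxtens_index (ord0, (mxtens_unindex i).2)) y.

(** The correction sum is written so that [cone_lagrange] shows it positive: [w w^* (x) S] is at
    most [|w|^2 I (x) S]. The coefficient [|w|^2 + 1] stays positive for [w = 0], so that eps can be
    divided by it. *)
Lemma lift_vec_ksum n (w : 'I_n -> R[i]) a S :
  ksum n (fun k => (sqnorm w + 1) * a k) S = lift_vec w (ksum 1 a S) +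
    \sum_k mxscale (a k)%:C (
      \matrix_(i, j) (((((mxtens_unindex i).1 == (mxtens_unindex j).1)%:R * (sqnorm w)%:C
            - w (mxtens_unindex i).1 * Num.conj (w (mxtens_unindex j).1))
       *: S k (mxtens_unindex i).2 (mxtens_unindex j).2)) + kronl (1%:M : 'M_n) (S k)).
Proof.
apply/matrixP => i j; rewrite /ksum [RHS]mxE [lift_vec _ _ _ _]mxE !summxE scaler_sumr -big_split.
apply: eq_bigr => k _ /=; rewrite !mxE !mxtens_indexK /= !scalerA -scalerDl scalerA -scalerDl.
congr (_ *: _); rewrite rmorphM rmorphD rmorph1.
by simpl; ring.
Qed.

Lemma pert_lift n (w : 'I_n -> R[i]) y a t : (forall k, 0 <= a k) -> (forall k, 0 <= t k) ->
  pert y a t ->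
  pert (lift_vec w y) (fun k => (sqnorm w + 1) * a k) (fun k => (sqnorm w + 1) * t k).
Proof.
move=> a0 t0 Cy; rewrite /pert !lift_vec_ksum.
have corr (b : 'I_N -> R) (S : 'I_N -> 'M[V]_m) : (forall k, C (S k)) -> (forall k, 0 <= b k) -> C (\sum_k mxscale (b k)%:C (
      \matrix_(i, j) (((((mxtens_unindex i).1 == (mxtens_unindex j).1)%:R * (sqnorm w)%:C
            - w (mxtens_unindex i).1 * Num.conj (w (mxtens_unindex j).1))
       *: S k (mxtens_unindex i).2 (mxtens_unindex j).2)) + kronl (1%:M : 'M_n) (S k))).
  move=> hS b0; apply: (cone_sum hV) => k _; apply: (cone_scale hV) => //.
  apply: (cone_add hV); last by apply: cone_kron.
  exact: (cone_lagrange hV (fun i : 'I_(n * m) => (mxtens_unindex i).1)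
    (fun i : 'I_(n * m) => (mxtens_unindex i).2)).
have := cone_add hV (cone_add hV (cone_pull hV (fun i : 'I_(n * m) => w (mxtens_unindex i).1)
  (fun i => mxtens_index (ord0, (mxtens_unindex i).2)) Cy) (corr _ _ hP a0)) (corr _ _ hQ t0).
congr (C _); rewrite !pullD -!addrA; congr (_ + (_ + _)).
by rewrite addrCA.
Qed.

Lemma pcone_lift n (w : 'I_n -> R[i]) (y : 'M[V]_(1 * m)) : pcone y -> pcone (lift_vec w y).
Proof.
move=> [yh hy]; have c0 : 0 < sqnorm w + 1.
  by rewrite ltr_wpDl // sumr_ge0 // => i _; apply: sqmod_ge0.
split.
  rewrite /lift_vec -{2}yh; apply/matrixP => i j; rewrite !mxE.
  by rewrite (starZ (os_star hV)) rmorphM /= conjCK mulrC.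
move=> eps e0; have er k : 0 < eps k / (sqnorm w + 1) by rewrite divr_gt0.
have rK a : (sqnorm w + 1) * (a / (sqnorm w + 1)) = a by rewrite mulrC divfK ?gt_eqF.
have [t [t0 xt ht]] := hy _ er.
exists (fun k => (sqnorm w + 1) * t k); split=> [k||i eps' /andP[e'0 e'lt]].
- exact: mulr_gt0.
- by apply: pert_mono (pert_lift w (fun k => ltW (er k)) (fun k => ltW (t0 k)) xt) => // k; rewrite rK.
have e'2 : 0 < eps' / (sqnorm w + 1) < eps i / (sqnorm w + 1).
  by rewrite divr_gt0 //= ltr_pM2r ?invr_gt0.
have [t' tt' xt'] := ht i _ e'2; exists ((sqnorm w + 1) * t'); first by rewrite ltr_pM2l.
have a'0 k : 0 <= [eta fun k => eps k / (sqnorm w + 1) with i |-> eps' / (sqnorm w + 1)] k.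
  by rewrite /=; case: ifP => _; rewrite ltW // divr_gt0.
have t'0 k : 0 <= [eta t with i |-> t'] k.
  by rewrite /=; case: ifP => _; rewrite ltW // (lt_trans (t0 i)).
by apply: pert_mono (pert_lift w a'0 t'0 xt') => k /=; case: ifP => _ //; rewrite rK.
Qed.

End PerturbationCones.

(** * Quotients by the span of the lineality space *)

Section LinearQuotients.
Variables (K : fieldType) (W : lmodType K) (S : set W).

Lemma lq_pi_eq (x y : W) : lq_pi S x = lq_pi S y <-> x - y \in lin_span S.
Proof. by rewrite Quotient.idealrBE; split=> [h|/eqP//]; apply/eqP. Qed.

Lemma lq_pi_linear : linear (lq_pi S).
Proof.
move=> a x y; rewrite -[a *: lq_pi S x]/(lq_scale a (lq_pi S x)) -lq_piZ.
exact: raddfD.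
Qed.

Lemma lin_spanP (x : W) : x \in lin_span S -> exists n (c : 'I_n -> K) (s : 'I_n -> W),
  (forall i, S (s i)) /\ x = \sum_i c i *: s i.
Proof. by move/asboolP. Qed.

End LinearQuotients.

Section MatrixSpaceEntries.
Variables (R : realType) (V : lmodType R[i]) (m : nat).
Implicit Types x y : matrixSpace V m.

Lemma matrixSpaceD x y (u v : 'I_m) :
  (x + y : 'M[V]_m) u v = (x : 'M[V]_m) u v + (y : 'M[V]_m) u v.
Proof. by rewrite mxE. Qed.

Lemma matrixSpaceZ (a : R[i]) x (u v : 'I_m) :
  (a *: x : matrixSpace V m) u v = a *: (x : 'M[V]_m) u v.
Proof. by rewrite /GRing.scale /= mxE. Qed.

End MatrixSpaceEntries.

Section QuotientEmbedding.
Variables (R : realType) (V : lmodType R[i]) (star : V -> V).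
Variables (C : forall n, set 'M[V]_n) (e : V) (hV : operator_system star C e).
Variables (m N : nat) (P Q : 'I_N -> 'M[V]_m).
Hypothesis hP : forall k, C (P k).
Hypothesis hQ : forall k, C (Q k).

Local Notation D := (pcone star C P Q).
Local Notation S := (cone_lineality D).
Local Notation MS := (matrixSpace V m).

Definition ampl n (x : 'M[V]_n) : 'M[V]_(n * m) :=
  \matrix_(i, j) x (mxtens_unindex i).1 (mxtens_unindex j).1.

Definition const_ampl n (x : 'M[V]_n) : 'M[MS]_n := map_mx (fun v => const_mx v : MS) x.

Lemma mxflatten_const_ampl n (x : 'M[V]_n) : mxflatten (const_ampl x) = ampl x.
Proof. by apply/matrixP => i j; rewrite !mxE. Qed.

Lemma map_cone_quot_map n (x : 'M[V]_n) :
  map_mx (cone_quot_map D) x = map_mx (lq_pi S) (const_ampl x).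
Proof. by apply/matrixP => i j; rewrite !mxE. Qed.

Lemma cone_ampl n (x : 'M[V]_n) : C x -> C (ampl x).
Proof.
move=> /(cone_pull hV (fun=> 1) (fun i : 'I_(n * m) => (mxtens_unindex i).1)).
by congr (C _); apply/matrixP => i j; rewrite !mxE rmorph1 mulr1 scale1r.
Qed.

Lemma pcone_sum n I r (F : I -> 'M[V]_(n * m)) : (forall i, D (F i)) ->
  D (\sum_(i <- r) F i).
Proof.
move=> h; apply: big_ind => //; last exact: (pcone_add hV).
by apply: (pcone_sub hV) => //; apply: mo0 (os_ordering hV) _.
Qed.

(** Polarization: [c e_i e_j^* + conj c e_j e_i^*] is [w w^*] for [w = e_i + conj c e_j], minus
    [e_i e_i^*] and [|c|^2 e_j e_j^*]. The subtractions are possible because [- s] is in the cone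
    too. *)
Lemma pcone_lineality_rank2 n (i j : 'I_n) (c : R[i]) (s : MS) : S s ->
  D (\matrix_(a, b) ((c * ((mxtens_unindex a).1 == i)%:R * ((mxtens_unindex b).1 == j)%:R +
       Num.conj c * ((mxtens_unindex a).1 == j)%:R * ((mxtens_unindex b).1 == i)%:R) *:
       (s : 'M[V]_m) (mxtens_unindex a).2 (mxtens_unindex b).2)).
Proof.
move=> [sD sND]; set y := mxflatten _ in sD sND.
have L w := pcone_lift hV hP hQ (n := n) w.
have := pcone_add hV hP hQ (pcone_add hV hP hQ
   (L (fun a => (a == i)%:R + Num.conj c * (a == j)%:R) _ sD)
   (L (fun a => (a == i)%:R) _ sND)) (L (fun a => c * (a == j)%:R) _ sND).
congr (pcone _ _ _ _ _); apply/matrixP => a b; rewrite !mxE !mxtens_indexK /= !mulr1n.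
rewrite !scalerN -!scalerBl; congr (_ *: _).
by rewrite rmorphD !rmorphM /= !rmorph_nat conjCK; ring.
Qed.

(** Each entry of [Z] is a complex combination of lineality elements, which are hermitian; every
    coefficient contributes one term of [pcone_lineality_rank2]. *)
Lemma pcone_span_herm n (Z : 'M[MS]_n) : (forall i j, Z i j \in lin_span S) ->
  D (mxflatten Z + mxstar star (mxflatten Z)).
Proof.
move=> ZS.
have sherm (s : MS) a b : S s -> star ((s : 'M[V]_m) b a) = (s : 'M[V]_m) a b.
  move=> [[h _] _]; have /matrixP := h.
  move=> /(_ (mxtens_index (ord0, a)) (mxtens_index (ord0, b))).
  by rewrite !mxE !mxtens_indexK /= !mulr1n.
have h i j : D (\matrix_(a, b)
   (((mxtens_unindex a).1 == i)%:R * ((mxtens_unindex b).1 == j)%:R *: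
      (Z i j : 'M[V]_m) (mxtens_unindex a).2 (mxtens_unindex b).2 +
    ((mxtens_unindex a).1 == j)%:R * ((mxtens_unindex b).1 == i)%:R *:
      star ((Z i j : 'M[V]_m) (mxtens_unindex b).2 (mxtens_unindex a).2))).
  have [r [c [s [sS ZE]]]] := lin_spanP (ZS i j).
  have := pcone_sum (index_enum 'I_r) (fun k => pcone_lineality_rank2 i j (c k) (sS k)).
  congr (pcone _ _ _ _ _); apply/matrixP => a b; rewrite summxE [RHS]mxE.
  have ent u v : (Z i j : 'M[V]_m) u v = \sum_k c k *: (s k : 'M[V]_m) u v.
    rewrite ZE; elim/big_rec2: _ => [|k x y _ <-]; first by rewrite mxE.
    by rewrite matrixSpaceD matrixSpaceZ.
  rewrite !ent (star_sum hV) !scaler_sumr -big_split; apply: eq_bigr => k _ /=.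
  rewrite mxE scalerDl (starZ (os_star hV)) sherm // !scalerA.
  by congr (_ *: _ + _ *: _); ring.
have := pcone_sum (index_enum 'I_n) (fun i => pcone_sum (index_enum 'I_n) (h i)).
congr (pcone _ _ _ _ _); apply/matrixP => a b; rewrite summxE.
have sel (u v : 'I_n) (F : 'I_n -> 'I_n -> V) :
    \sum_i \sum_j ((u == i)%:R * (v == j)%:R) *: F i j = F u v.
  rewrite (bigD1 u) //= [X in _ + X]big1 ?addr0 => [|k /negPf ku]; last first.
    by apply: big1 => l _; rewrite eq_sym ku mul0r scale0r.
  rewrite (bigD1 v) //= [X in _ + X]big1 ?addr0 => [|k /negPf kv]; last first.
    by rewrite [v == _]eq_sym kv mulr0 scale0r.
  by rewrite !eqxx mulr1 scale1r.
under eq_bigr => i _ do (rewrite summxE; under eq_bigr => j _ do rewrite mxE).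
under eq_bigr => i _ do rewrite big_split.
rewrite big_split /= sel [X in _ + X](_ : _ = \sum_i \sum_j
   (((mxtens_unindex b).1 == i)%:R * ((mxtens_unindex a).1 == j)%:R) *:
    star ((Z i j : 'M[V]_m) (mxtens_unindex b).2 (mxtens_unindex a).2)).
  by rewrite sel !mxE.
by apply: eq_bigr => i _; apply: eq_bigr => j _; rewrite [_ * _%:R]mulrC.
Qed.

Lemma cone_quot_embedding :
  complete_order_embedding C (cone_quot_cone D) (cone_quot_map D) <->
  forall n (x : 'M[V]_n), D (ampl x) -> C x.
Proof.
split=> [[_ _ _ inv] n x Dx|core].
  apply: inv; exists (const_ampl x); last by rewrite map_cone_quot_map.
  by rewrite /= mxflatten_const_ampl.
have D0 n : D (0 : 'M[V]_(n * m)) by apply: (pcone_sub hV) => //; apply: mo0 (os_ordering hV) _.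
have lin : linear (cone_quot_map D).
  move=> a u v; rewrite -[RHS]lq_pi_linear; congr lq_pi.
  by apply/matrixP => i j; rewrite /GRing.scale /= !mxE.
have inv n (x : 'M[V]_n) : cone_quot_cone D n (map_mx (cone_quot_map D) x) -> C x.
  move=> [Y DY]; rewrite map_cone_quot_map => /matrixP YE.
  pose Z : 'M[MS]_n := const_ampl x - Y.
  have ZS i j : Z i j \in lin_span S.
    by rewrite /Z !mxE; apply/lq_pi_eq; have := YE i j; rewrite !mxE => ->.
  have flatZ : mxflatten Z = ampl x - mxflatten Y.
    by apply/matrixP => a b; rewrite !mxE.
  have Yh := DY.1.
  have starB u v : star (u - v) = star u - star v.
    by rewrite (starD (os_star hV)) (starN hV).
  (* [Y] is hermitian, so the ampliation of the sum is [Y + Y] plus [Z] and its adjoint. *)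
  have Cre : C (x + mxstar star x).
    apply: core; have := pcone_add hV hP hQ (pcone_add hV hP hQ DY DY) (pcone_span_herm ZS).
    congr (pcone _ _ _ _ _); rewrite flatZ; apply/matrixP => a b.
    have /matrixP/(_ a b) := Yh; rewrite !mxE starB => ->.
    by rewrite addrACA !subrKC.
  (* For imaginary [c] the contribution of the hermitian [Y] cancels from [c Z] plus its adjoint. *)
  have Cim (c : R[i]) : Num.conj c = - c -> C (mxscale c (x - mxstar star x)).
    move=> cc; apply: core.
    pose Z' : 'M[MS]_n := map_mx (fun z : MS => c *: z) Z.
    have Z'S i j : Z' i j \in lin_span S by rewrite mxE rpredZ.
    have := pcone_span_herm Z'S; congr (pcone _ _ _ _ _).
    apply/matrixP => a b; have /matrixP/(_ a b) := Yh; rewrite !mxE => Yab.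
    rewrite !(starZ (os_star hV)) starB cc Yab scaleNr -scalerBr.
    by rewrite opprB addrA subrK.
  have xh := mxstar_fixed hV Cim.
  move: Cre; rewrite xh => Cre; apply: (cone_scaleK hV (r := 2)) => //.
  move: Cre; congr (C _); apply/matrixP => i j; rewrite !mxE rmorph_nat.
  by rewrite scaler_nat mulr2n.
split=> //.
- apply: (order_embedding_inj hV lin) => v v0; apply: inv; exists 0.
    by have := D0 1%N; congr (pcone _ _ _ _ _); apply/matrixP => a b; rewrite !mxE.
  apply/matrixP => i j; rewrite !mxE !ord1 eqxx mulr1n v0.
  exact: linear_fun0 (@lq_pi_linear _ _ S).
- move=> n x Cx; exists (const_ampl x); last by rewrite map_cone_quot_map.
  by rewrite /= mxflatten_const_ampl; apply: (pcone_sub hV) => //; apply: cone_ampl.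
Qed.

End QuotientEmbedding.

(** * Abstract projections *)

Lemma sum_mxtens (Z : nmodType) n m (F : 'I_(n * m) -> Z) :
  \sum_A F A = \sum_i \sum_s F (mxtens_index (i, s)).
Proof.
rewrite pair_bigA /= (reindex (@mxtens_index n m)) /=; first by apply: eq_bigr => -[].
by exists (@mxtens_unindex n m) => A _; rewrite ?mxtens_indexK ?mxtens_unindexK.
Qed.

Section HilbertForms.
Variables (R : realType) (H : hilbertSpace R).

Lemma bopD (f g : boundedOperator H) v : (f + g) v = f v + g v. Proof. by []. Qed.

Lemma bopZ (a : R[i]) (f : boundedOperator H) v : (a *: f) v = a *: f v. Proof. by []. Qed.

Lemma bop0 v : (0 : boundedOperator H) v = 0. Proof. by []. Qed.

Lemma bop_linear (f : boundedOperator H) : linear f.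
Proof. by case: f => f /= /asboolP[]. Qed.

Lemma hdotDl (u v w : H) : hdot H (u + v) w = hdot H u w + hdot H v w.
Proof. exact: linearDl. Qed.

Lemma hdotDr (u v w : H) : hdot H w (u + v) = hdot H w u + hdot H w v.
Proof. exact: linearDr. Qed.

Lemma hdotZl (a : R[i]) (u w : H) : hdot H (a *: u) w = a * hdot H u w.
Proof. exact: linearZl_LR. Qed.

Lemma hdot0l (w : H) : hdot H 0 w = 0.
Proof. exact: linear0l. Qed.

End HilbertForms.

Section ProjectionCone.
Variables (R : realType) (V : lmodType R[i]) (star : V -> V).
Variables (C : forall n, set 'M[V]_n) (e : V) (hV : operator_system star C e).

Lemma dsumE (p q : V) (i j : 'I_2) :
  dsum p q i j = if i == j then (if odd i then q else p) else 0.
Proof.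
rewrite /dsum; case: (split_ordP (i : 'I_(1 + 1))) => i' ->;
  case: (split_ordP (j : 'I_(1 + 1))) => j' ->.
- by apply: etrans (block_mxEul _ _ _ _ _ _) _; rewrite !ord1 mxE eqxx mulr1n.
- by apply: etrans (block_mxEur _ _ _ _ _ _) _; rewrite mxE !ord1.
- by apply: etrans (block_mxEdl _ _ _ _ _ _) _; rewrite mxE !ord1.
- by apply: etrans (block_mxEdr _ _ _ _ _ _) _; rewrite !ord1 mxE eqxx mulr1n.
Qed.

Lemma kron1E n m (x : 'M[V]_m) (i j : 'I_n) s t :
  kronl (1%:M : 'M_n) x (mxtens_index (i, s)) (mxtens_index (j, t)) = (i == j)%:R *: x s t.
Proof. by rewrite mxE !mxtens_indexK /= mxE. Qed.

Lemma cone_dsum p q : C (p%:M : 'M[V]_1) -> C (q%:M : 'M[V]_1) -> C (dsum p q).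
Proof.
move=> Cp Cq.
have := cone_add hV (cone_pull hV (fun i : 'I_2 => (~~ odd i)%:R) (fun=> ord0) Cp)
  (cone_pull hV (fun i : 'I_2 => (odd i)%:R) (fun=> ord0) Cq).
congr (C _); apply/matrixP => i j; rewrite dsumE !mxE !rmorph_nat !mulr1n -!natrM.
by case: i j => [[|[|//]] ?] [[|[|//]] ?] /=; rewrite ?scale0r ?scale1r ?addr0 ?add0r.
Qed.

Variables (p : V) (hp : positive_contraction C e p).

(** The definitions differ by the clause on smaller [eps']. It is met by raising [t'], since a
    larger multiple of the positive [Q] keeps membership. *)
Lemma CprojE : Cproj star C e p =
  pcone star C (fun _ : 'I_1 => dsum p (e - p)) (fun _ : 'I_1 => dsum (e - p) p).
Proof.
have [Cp Cq] := hp.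
have ksum1 n a S : ksum n a S = mxscale (a ord0)%:C (kronl 1%:M (S (ord0 : 'I_1))) :> 'M[V]_(n * 2).
  by rewrite /ksum big_ord1.
have CQ : forall k : 'I_1, C (dsum (e - p) p) by move=> _; apply: cone_dsum.
have CP : forall k : 'I_1, C (dsum p (e - p)) by move=> _; apply: cone_dsum.
apply: functional_extensionality_dep => n; apply/seteqP; split=> x [xh hx]; split=> //.
  move=> eps e0; have [t t0 xt] := hx _ (e0 ord0); exists (fun=> t); split=> //.
    by rewrite /pert !ksum1.
  move=> i eps' /andP[e'0 _]; have [t' t'0 xt'] := hx _ e'0; exists (Num.max t' (t + 1)).
    by rewrite lt_max ltrDl ltr01 orbT.
  apply: (pert_mono hV CP CQ (eps := fun=> eps') (t := fun=> t')) => // [k|k|].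
  - by rewrite /= !ord1.
  - by rewrite /= !ord1 /= le_max lexx.
  - by rewrite /pert !ksum1.
move=> eps e0; have [|t [t0 xt _]] := hx (fun=> eps) => //.
by exists (t ord0) => //; move: xt; rewrite /pert !ksum1.
Qed.

Lemma cone_kron_dsum n q r : C (q%:M : 'M[V]_1) -> C (r%:M : 'M[V]_1) ->
  C (kronl (1%:M : 'M_n) (dsum q r)).
Proof. by move=> Cq Cr; apply: (cone_kron hV); apply: cone_dsum. Qed.

Lemma Cproj_embedding :
  complete_order_embedding C (cone_quot_cone (Cproj star C e p))
    (cone_quot_map (Cproj star C e p)) <->
  forall n (x : 'M[V]_n), Cproj star C e p (ampl 2 x) -> C x.
Proof.
rewrite CprojE; have [Cp Cq] := hp.
by apply: (cone_quot_embedding hV) => _; apply: cone_dsum.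
Qed.

Section Representation.
Variables (H : hilbertSpace R) (pi : V -> boundedOperator H).
Hypothesis pi_linear : linear pi.

Definition opform n (X : 'M[V]_n) (g : 'I_n -> H) : R[i] :=
  \sum_A \sum_B hdot H (pi (X A B) (g B)) (g A).

Lemma opformD n (X Y : 'M[V]_n) g : opform (X + Y) g = opform X g + opform Y g.
Proof.
rewrite /opform -big_split; apply: eq_bigr => A _; rewrite -big_split /=.
apply: eq_bigr => B _; by rewrite mxE -hdotDl -bopD (linear_funD pi_linear).
Qed.

Lemma opformZ n (a : R[i]) (X : 'M[V]_n) g : opform (mxscale a X) g = a * opform X g.
Proof.
rewrite /opform mulr_sumr; apply: eq_bigr => A _; rewrite mulr_sumr.
apply: eq_bigr => B _; by rewrite mxE (linear_funZ pi_linear) bopZ hdotZl.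
Qed.

Lemma opform_kron n q r (g : 'I_(n * 2) -> H) : opform (kronl (1%:M : 'M_n) (dsum q r)) g =
  \sum_i (hdot H (pi q (g (mxtens_index (i, ord0)))) (g (mxtens_index (i, ord0))) +
          hdot H (pi r (g (mxtens_index (i, ord_max)))) (g (mxtens_index (i, ord_max)))).
Proof.
have dot0 v u : hdot H (pi 0 v) u = 0 by rewrite (linear_fun0 pi_linear) bop0 hdot0l.
rewrite /opform sum_mxtens; apply: eq_bigr => i _.
rewrite big_ord_recl big_ord1 /=.
rewrite !sum_mxtens !(bigD1 i (P := predT)) //=.
have -> : lift ord0 ord0 = ord_max :> 'I_2 by apply: val_inj.
have vanish s : \sum_(k < n | k != i) \sum_t hdot H
   (pi (kronl 1%:M (dsum q r) (mxtens_index (i, s)) (mxtens_index (k, t)))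
      (g (mxtens_index (k, t)))) (g (mxtens_index (i, s))) = 0.
  apply: big1 => k ki; apply: big1 => t _.
  by rewrite kron1E eq_sym (negPf ki) scale0r dot0.
rewrite !vanish !addr0 !big_ord_recl !big_ord0 !addr0.
have -> : lift ord0 ord0 = ord_max :> 'I_2 by apply: val_inj.
by rewrite !kron1E eqxx !scale1r !dsumE /= !dot0 addr0 add0r.
Qed.

Lemma opform_ampl n (x : 'M[V]_n) (g : 'I_(n * 2) -> H) : opform (ampl 2 x) g =
  opform x (fun i => g (mxtens_index (i, ord0)) + g (mxtens_index (i, ord_max))).
Proof.
rewrite /opform sum_mxtens; apply: eq_bigr => i _.
under eq_bigr => s _ do rewrite sum_mxtens.
rewrite exchange_big; apply: eq_bigr => j _ /=.
rewrite !big_ord_recl !big_ord0 !addr0 !mxE !mxtens_indexK /= (linear_funD (@bop_linear _ _ _)).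
have -> : lift ord0 ord0 = ord_max :> 'I_2 by apply: val_inj.
by rewrite hdotDr !hdotDl.
Qed.

End Representation.

(* The vector [(p h_i, p^perp h_i)_i] is annihilated by the form of [Q]. *)
Lemma abstract_projection_core : abstract_projection C e p ->
  forall n (x : 'M[V]_n), Cproj star C e p (ampl 2 x) -> C x.
Proof.
move=> [_ [H [pi [[lin _ cp inv] pie [idem sym]]]]] n x [_ hx]; apply: inv => h.
have piq v : pi (e - p) v = v - pi p v.
  by rewrite (linear_funB lin) -scaleN1r bopD bopZ scaleN1r pie.
pose g (A : 'I_(n * 2)) := if odd (mxtens_unindex A).2 then pi (e - p) (h (mxtens_unindex A).1)
   else pi p (h (mxtens_unindex A).1).
have g0 i : g (mxtens_index (i, ord0)) = pi p (h i) by rewrite /g mxtens_indexK.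
have g1 i : g (mxtens_index (i, ord_max)) = pi (e - p) (h i) by rewrite /g mxtens_indexK.
pose K := opform pi (kronl (1%:M : 'M_n) (dsum p (e - p))) g.
(* The size of [t] is not controlled; this is harmless as the form of [Q] vanishes at [g]. *)
have main eps : 0 < eps -> 0 <= opform pi x h + eps%:C * K.
  move=> e0; have [t t0 /cp/(_ g)] := hx _ e0.
  have -> : \sum_i \sum_j hdot H (map_mx pi (ampl 2 x + mxscale eps%:C
      (kronl 1%:M (dsum p (e - p))) + mxscale t%:C (kronl 1%:M (dsum (e - p) p))) i j (g j)) (g i)
    = opform pi (ampl 2 x + mxscale eps%:C
      (kronl 1%:M (dsum p (e - p))) + mxscale t%:C (kronl 1%:M (dsum (e - p) p))) g.
    by apply: eq_bigr => i _; apply: eq_bigr => j _; rewrite mxE.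
  rewrite !opformD // !opformZ // opform_ampl // -/K.
  have -> : opform pi (kronl 1%:M (dsum (e - p) p)) g = 0.
    rewrite opform_kron // big1 // => i _; rewrite g0 g1 !piq !(linear_funB (@bop_linear _ _ _)) !idem !subrr.
    by rewrite !hdot0l addr0.
  rewrite mulr0 addr0; congr (_ <= opform _ _ _ + _).
  by apply: funext => i; rewrite g0 g1 piq addrC subrK.
have -> : \sum_i \sum_j hdot H (map_mx pi x i j (h j)) (h i) = opform pi x h.
  by apply: eq_bigr => i _; apply: eq_bigr => j _; rewrite mxE.
(* [K] does not depend on eps, and eps is taken as [d / (|K| + 1)]. *)
apply: ge0_approx => ep ep0.
have [d d0 dE] := RtoC_gt0P ep0.
have K1 : 0 < `|K| + 1 by rewrite ltr_wpDl.
have [c c0 cE] := RtoC_gt0P K1.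
exists (opform pi x h + (d / c)%:C * K); first by apply: main; rewrite divr_gt0.
rewrite addrC addKr normrM ger0_norm ?ler0c ?divr_ge0 ?ltW //.
have -> : (d / c)%:C = ep / (`|K| + 1) by rewrite cE dE rmorphM fmorphV.
rewrite mulrAC ltr_pdivrMr // ltr_pM2l // ltrDl //.
Qed.

End ProjectionCone.

(** * From a separating functional to a map that sends [p] to a projection *)

Section Separation.
Variables (R : realType) (V : lmodType R[i]) (star : V -> V).
Variables (C : forall n, set 'M[V]_n) (e : V) (hV : operator_system star C e).

Let hs : is_star star := os_star hV.

Lemma sum_delta (I : finType) (Z : lmodType R[i]) (u : I) (F : I -> Z) :
  \sum_k (u == k)%:R *: F k = F u.
Proof.
rewrite (bigD1 u) //= big1 ?eqxx ?scale1r ?addr0 // => k /negPf ku.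
by rewrite eq_sym ku scale0r.
Qed.

Definition munit m (A B : 'I_m) (v : V) : 'M[V]_m :=
  \matrix_(a, b) (((a == A)%:R * (b == B)%:R : R[i]) *: v).

Lemma mxstarZ m (a : R[i]) (X : 'M[V]_m) :
  mxstar star (mxscale a X) = mxscale (Num.conj a) (mxstar star X).
Proof. by apply/matrixP => i j; rewrite !mxE (starZ hs). Qed.

Lemma mxstarD m (X Y : 'M[V]_m) : mxstar star (X + Y) = mxstar star X + mxstar star Y.
Proof. by apply/matrixP => i j; rewrite !mxE (starD hs). Qed.

Lemma mxstarN m (X : 'M[V]_m) : mxstar star (- X) = - mxstar star X.
Proof. by apply/matrixP => i j; rewrite !mxE (starN hV). Qed.

Lemma mxstarK m (X : 'M[V]_m) : mxstar star (mxstar star X) = X.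
Proof. by apply/matrixP => i j; rewrite !mxE (starK hs). Qed.

Lemma munit_star m (A B : 'I_m) v : mxstar star (munit A B v) = munit B A (star v).
Proof. by apply/matrixP => i j; rewrite !mxE (starZ hs) rmorphM !rmorph_nat mulrC. Qed.

Section Choi.
Variables (m : nat) (F : matrixSpace V m -> R[i]).
Hypothesis FD : forall X Y, F (X + Y) = F X + F Y.
Hypothesis FZ : forall a X, F (a *: X) = a * F X.

Let F_sum I r (G : I -> matrixSpace V m) :
  F (\sum_(i <- r) G i) = \sum_(i <- r) F (G i).
Proof.
elim: r => [|i r ih]; last by rewrite !big_cons FD ih.
by rewrite !big_nil -(scale0r (0 : matrixSpace V m)) FZ mul0r.
Qed.

Definition choi (v : V) : 'M[R[i]]_m := \matrix_(A, B) F (munit A B v).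

(** The argument of [F] is the compression of [x] by the conjugated vectors [h i], so complete
    positivity of [choi] becomes positivity of [F] on [C]. *)
Lemma choi_form n (x : 'M[V]_n) (h : 'I_n -> 'cV[R[i]]_m) :
  \sum_i \sum_j sesq (choi (x i j)) (h i) (h j) =
  F (\matrix_(A, B) \sum_i \sum_j (Num.conj (h i A 0) * h j B 0) *: x i j).
Proof.
have -> : (\matrix_(A, B) \sum_i \sum_j (Num.conj (h i A 0) * h j B 0) *: x i j) =
   \sum_i \sum_j \sum_A \sum_B
     ((Num.conj (h i A 0) * h j B 0) *: (munit A B (x i j) : matrixSpace V m)).
  apply/matrixP => A B; rewrite mxE summxE; apply: eq_bigr => i _.
  rewrite summxE; apply: eq_bigr => j _; rewrite summxE.
  rewrite -[LHS](sum_delta A (fun A' => (Num.conj (h i A' 0) * h j B 0) *: x i j)).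
  apply: eq_bigr => A' _; rewrite summxE.
  rewrite -[X in _ *: X](sum_delta B (fun B' => (Num.conj (h i A' 0) * h j B' 0) *: x i j)).
  rewrite scaler_sumr; apply: eq_bigr => B' _.
  by rewrite matrixSpaceZ mxE !scalerA; congr (_ *: _); ring.
rewrite F_sum; apply: eq_bigr => i _; rewrite F_sum; apply: eq_bigr => j _.
rewrite sesqE F_sum; apply: eq_bigr => A _; rewrite F_sum; apply: eq_bigr => B _.
by rewrite FZ mxE mulrAC.
Qed.

Hypothesis Fstar : forall X : 'M[V]_m, F (mxstar star X) = Num.conj (F X).
Hypothesis Fpos : forall X : 'M[V]_m, C X -> 0 <= F X.

Lemma choi_cpmap : cpmap star C choi.
Proof.
split=> [a u v|v|n x h Cx].
- apply/matrixP => A B; rewrite !mxE -FZ -FD; congr F; apply/matrixP => i j.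
  by rewrite matrixSpaceD matrixSpaceZ !mxE scalerDr !scalerA [a * _]mulrC.
- by apply/matrixP => A B; rewrite !mxE -Fstar munit_star.
rewrite choi_form; apply: Fpos.
have := mo_compress (os_ordering hV) (\matrix_(A, i) Num.conj (h i A 0)) Cx.
congr (C _); apply/matrixP => A B; rewrite !mxE; apply: eq_bigr => i _.
by apply: eq_bigr => j _; rewrite !mxE conjCK.
Qed.

End Choi.

Variables (p : V) (hp : positive_contraction C e p).
Local Notation D := (Cproj star C e p).

Let Pd := dsum p (e - p).
Let Qd := dsum (e - p) p.

Lemma Cproj_add n (X Y : 'M[V]_(n * 2)) : D X -> D Y -> D (X + Y).
Proof. by rewrite (CprojE hV hp); have [? ?] := hp; apply: (pcone_add hV) => _; apply: (cone_dsum hV). Qed.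

Lemma Cproj_scale n (r : R) (X : 'M[V]_(n * 2)) : 0 < r -> D X -> D (mxscale r%:C X).
Proof. by rewrite (CprojE hV hp); have [? ?] := hp; apply: (pcone_scale hV) => _; apply: (cone_dsum hV). Qed.

Lemma Cproj_sub n (X : 'M[V]_(n * 2)) : C X -> D X.
Proof. by rewrite (CprojE hV hp); have [? ?] := hp; apply: (pcone_sub hV) => _; apply: (cone_dsum hV). Qed.

Lemma kron_dsum_unit n :
  kronl (1%:M : 'M_n) Pd + kronl (1%:M : 'M_n) Qd = (e%:M : 'M[V]_(n * 2)).
Proof.
apply/matrixP => A B; rewrite [LHS]mxE.
case: (mxtens_indexP A) => i s; case: (mxtens_indexP B) => j t.
rewrite !kron1E !dsumE -scalerDr !mxE.
rewrite (can_eq (@mxtens_indexK n 2)) xpair_eqE.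
case: (i == j); rewrite ?scale0r // scale1r; case: (s == t); rewrite ?addr0 //.
by case: odd; rewrite ?subrK // addrC subrK.
Qed.

(** The unit is [P + Q]. The hypothesis is used with [r = eps / 2] and tolerance [eps / 2]: the [P]
    parts add up to eps, and the [Q] part joins [t]. *)
Lemma Cproj_arch n (X : 'M[V]_(n * 2)) :
  (forall r : R, 0 < r -> D (mxscale r%:C e%:M + X)) -> D X.
Proof.
move=> h; split.
  have [hh _] := h 1 ltr01; move: hh; rewrite mxstarD mxstarZ.
  have -> : mxstar star (e%:M : 'M[V]_(n * 2)) = e%:M.
    apply/matrixP => i j; rewrite !mxE eq_sym; case: eqP => // _.
      exact: os_unit_herm hV.
    by rewrite !mulr0n (star0 hV).
  rewrite conj_real.
  exact: addrI.
move=> eps e0; have e2 : 0 < eps / 2 by rewrite divr_gt0.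
have [_ /(_ _ e2)[t t0 Ct]] := h _ e2; exists (t + eps / 2); first exact: addr_gt0.
move: Ct; congr (C _); rewrite -kron_dsum_unit.
rewrite -/Pd -/Qd; move: (kronl _ Pd) (kronl _ Qd) => K1 K2.
apply/matrixP => A B; rewrite !mxE scalerDr.
move: (K1 A B) (K2 A B) (X A B) => a b c.
have -> : (t + eps / 2)%:C = t%:C + (eps / 2)%:C by rewrite rmorphD.
have -> : eps%:C = (eps / 2)%:C + (eps / 2)%:C by rewrite -rmorphD /= -splitr.
rewrite ![(_ + _) *: _]scalerDl.
rewrite [_ + c]addrC -!addrA; congr (c + (_ + _)).
by rewrite addrCA; congr (_ + _); rewrite addrC.
Qed.

Lemma munit_cone m (A : 'I_m) v : C (v%:M : 'M[V]_1) -> C (munit A A v).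
Proof.
move=> /(cone_pull hV (fun B : 'I_m => (B == A)%:R) (fun=> ord0)); congr (C _).
by apply/matrixP => i j; rewrite !mxE rmorph_nat mulr1n.
Qed.

(** With [t = 1], the summand of [I (x) Q] at the place [A] cancels the negative term. A functional
    nonnegative on [D] therefore vanishes on this diagonal entry. *)
Lemma Cproj_diag n (A : 'I_(n * 2)) :
  D (- munit A A (if odd (mxtens_unindex A).2 then p else e - p)).
Proof.
have [Cp Cq] := hp.
have q_pos s : C ((if odd s then p else e - p)%:M : 'M[V]_1) by case: odd.
split; first by rewrite mxstarN munit_star (cone_herm1 hV).
move=> eps e0; exists 1 => //; rewrite -/Pd -/Qd.
have -> : kronl (1%:M : 'M_n) Qd =
   \sum_(B < n * 2) munit B B (if odd (mxtens_unindex B).2 then p else e - p).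
  apply/matrixP => i j; rewrite summxE.
  under eq_bigr => B _ do rewrite mxE -scalerA.
  rewrite (sum_delta i (fun B => (j == B)%:R *: (if odd (mxtens_unindex B).2 then p else e - p))).
  case: (mxtens_indexP i) => i' s; case: (mxtens_indexP j) => j' t.
  rewrite kron1E dsumE mxtens_indexK (can_eq (@mxtens_indexK n 2)) xpair_eqE /=.
  rewrite [j' == _]eq_sym [t == _]eq_sym; case: (i' == j'); rewrite ?scale0r //.
  by case: (s == t); rewrite ?scale1r ?scaler0 ?scale0r.
rewrite (bigD1 A) //=.
have -> (a b c : 'M[V]_(n * 2)) : - a + b + mxscale 1%:C (a + c) = b + c.
  have -> : mxscale 1%:C (a + c) = a + c by apply/matrixP => i j; rewrite !mxE scale1r.
  by rewrite addrACA addNr add0r.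
apply: (cone_add hV); first by apply: (cone_scale hV); [exact: ltW|apply: (cone_kron_dsum hV)].
by apply: (cone_sum hV) => B _; apply: munit_cone.
Qed.

Lemma cone_unit n : C (e%:M : 'M[V]_n).
Proof.
have := cone_block_diag hV (id : 'I_n -> 'I_n) (fun=> ord0) (os_unit_pos hV).
congr (C _); apply/matrixP => i j; rewrite !mxE mulr1n.
by rewrite scaler_nat.
Qed.

Lemma projection_ucp_separation n (x : 'M[V]_n) :
    (forall n (x : 'M[V]_n), D (ampl 2 x) -> C x) -> mxstar star x = x -> ~ C x ->
  exists r (phi : V -> 'M[R[i]]_r), [/\ ucp star C e phi, phi p *m phi p = phi p
    & exists g : 'I_n -> 'cV_r, ~~ (0 <= \sum_i \sum_j sesq (phi (x i j)) (g i) (g j))].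
Proof.
move=> core xh nCx; pose W := matrixSpace V (n * 2).
(* All elements of [D] are hermitian. Testing the hermitian part instead makes [e%:M] an order unit
   for the whole complex space, and forces the functional to vanish on skew matrices. *)
pose K : set W := [set X | D ((X : 'M[V]_(n * 2)) + mxstar star X)].
have WZ (a : R[i]) (X : W) : a *: X = mxscale a X :> 'M[V]_(n * 2) by [].
have Kadd X Y : K X -> K Y -> K (X + Y).
  move=> KX KY; have := Cproj_add KX KY; rewrite /K /= addrACA.
  by rewrite -mxstarD.
have KZ (r : R) X : 0 < r -> K X -> K (r%:C *: X).
  move=> r0 KX; have := Cproj_scale r0 KX; congr (Cproj _ _ _ _ _).
  rewrite WZ mxstarZ conj_real.
  by apply/matrixP => i j; rewrite !mxE scalerDr.
pose u : W := (e%:M : 'M[V]_(n * 2)).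
have us : mxstar star u = u by apply: (mo_herm (os_ordering hV)); apply: cone_unit.
have uK (r : R) (X : W) : (r%:C *: u + X : 'M[V]_(n * 2)) + mxstar star (r%:C *: u + X : W) =
    mxscale (r + r)%:C (e%:M) + ((X : 'M[V]_(n * 2)) + mxstar star X).
  rewrite mxstarD WZ mxstarZ us conj_real.
  by rewrite addrACA; congr (_ + _); apply/matrixP => i j; rewrite !mxE rmorphD scalerDl.
have Kunit X : exists2 r : R, 0 < r & K (r%:C *: u - X).
  have [|r r0 Cr] := os_unit hV (x := (X : 'M[V]_(n * 2)) + mxstar star X).
    by rewrite mxstarD mxstarK addrC.
  exists (r / 2); first by rewrite divr_gt0.
  rewrite /K /= uK -splitr mxstarN -opprD; exact: Cproj_sub.
have Karch X : (forall r : R, 0 < r -> K (r%:C *: u + X)) -> K X.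
  move=> h; apply: Cproj_arch => r r0; have r2 : 0 < r / 2 by rewrite divr_gt0.
  by have := h _ r2; rewrite /K /= uK -splitr.
have Kx : ~ K (ampl 2 x).
  move=> Kx; apply: nCx; apply: (cone_scaleK hV (r := 2)) => //; apply: core.
  move: Kx; congr (Cproj _ _ _ _ _); apply/matrixP => A B; have /matrixP/(_ (mxtens_unindex A).1 (mxtens_unindex B).1) := xh.
  by rewrite !mxE => ->; rewrite rmorph_nat scaler_nat mulr2n.
have Ku : ~ K (- u).
  move=> Ku; apply: Kx; have [r r0 Kr] := Kunit (- (ampl 2 x : W)).
  have := Kadd _ _ (KZ _ _ r0 Ku) Kr; rewrite opprK addrA scalerN addNr add0r.
  by [].
have [f [fD fZ fK fx]] := cone_separation (conj Kadd KZ) Ku Kunit Karch Kx.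
have fN X : f (- X) = - f X.
  by have := fZ (-1) X; rewrite rmorphN scaleN1r mulN1r.
have D0 : D (0 : 'M[V]_(n * 2)) by apply: Cproj_sub; apply: (mo0 (os_ordering hV)).
have fstar (X : W) : f (mxstar star X : W) = f X.
  have skew (Y : W) : mxstar star Y = - (Y : 'M[V]_(n * 2)) -> f Y = 0.
    move=> Ys; apply/eqP; rewrite eq_le -oppr_ge0 -fN; apply/andP; split; apply: fK.
      by rewrite /K /= mxstarN Ys opprK addNr.
    by rewrite /K /= Ys subrr.
  apply/eqP; rewrite -subr_eq0 -fN -fD; apply/eqP; apply: skew.
  by rewrite mxstarD mxstarN mxstarK opprB addrC.
(* The complex linear functional with real part [f]. *)
pose F (X : W) : R[i] := f X +i* (- f ('i *: X)).
have FD X Y : F (X + Y) = F X + F Y.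
  by apply/eqP; rewrite eq_complex /= scalerDr !fD opprD !eqxx.
have cZ (a : R[i]) (X : W) : a *: X = (complex.Re a)%:C *: X + (complex.Im a)%:C *: ('i *: X).
  by rewrite scalerA -scalerDl {1}[a]complexE [_ * 'i]mulrC.
have FZ a X : F (a *: X) = a * F X.
  have ii : 'i *: ('i *: X) = - X by rewrite scalerA -expr2 sqr_i scaleN1r.
  have ia : 'i *: (a *: X) = a *: ('i *: X) by rewrite !scalerA mulrC.
  rewrite /F ia (cZ a X) (cZ a ('i *: X)) ii !fD !fZ fN.
  case: a {ia} => a b /=; apply/eqP; rewrite eq_complex /=.
  by apply/andP; split; apply/eqP; ring.
have Fstar (X : 'M[V]_(n * 2)) : F (mxstar star X) = Num.conj (F X).
  have -> : F (mxstar star X) = f X +i* f ('i *: (X : W)).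
    rewrite /F fstar -fN -scaleNr; congr (_ +i* _).
    rewrite -[in RHS]fstar (WZ 'i) mxstarZ; congr f.
    by congr (_ *: _); apply/eqP; rewrite eq_complex /= oppr0 !eqxx.
  by apply/eqP; rewrite eq_complex /= opprK !eqxx.
have ReFK (X : 'M[V]_(n * 2)) : mxstar star X = X -> F X = (f X)%:C.
  move=> Xs; apply/eqP; rewrite eq_complex /= eqxx /=.
  have := Fstar X; rewrite Xs => /eqP; rewrite eq_complex /= => /andP[_ /eqP h].
  by move: h; lra.
have FposD (X : 'M[V]_(n * 2)) : D X -> 0 <= F X.
  move=> DX; rewrite ReFK; last by case: DX.
  rewrite ler0c; apply: fK; rewrite /K /=.
  by have [-> _] := DX; apply: Cproj_add.
have Fpos (X : 'M[V]_(n * 2)) : C X -> 0 <= F X by move=> /Cproj_sub; exact: FposD.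
have cpm := choi_cpmap FD FZ Fstar Fpos.
have form := @choi_form _ F FD FZ.
have psiE v A B : choi F v A B = F (munit A B v) by rewrite mxE.
move: (choi F) cpm form psiE => psi cpm form psiE.
have [Cp Cq] := hp.
pose E : 'M[R[i]]_(n * 2) := \matrix_(A, B) ((A == B) && ~~ odd (mxtens_unindex A).2)%:R.
(* The diagonal entry at [A] is both nonnegative and nonpositive, and a positive semidefinite matrix
   with a zero diagonal entry kills that basis vector. *)
have diag0 (A : 'I_(n * 2)) :
    psi (if odd (mxtens_unindex A).2 then p else e - p) *m delta_mx A 0 = 0 :> 'cV_(n * 2).
  set q := if _ then _ else _.
  have Cqq : C (q%:M : 'M[V]_1) by rewrite /q; case: odd.
  have qs := cone_herm1 hV Cqq.
  apply: psd_ker; first by rewrite -(cpmap_star cpm) qs.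
    by move=> g; apply: (cpmap_psd cpm).
  rewrite sesqE (bigD1 A) //= [X in _ + X]big1 ?addr0 => [|B BA]; last first.
    apply: big1 => B' _; rewrite mxE (negPf BA) rmorph0 !mul0r //.
  rewrite (bigD1 A) //= [X in _ + X]big1 ?addr0 => [|B BA]; last first.
    by rewrite [X in _ * X]mxE (negPf BA) mulr0.
  rewrite psiE !mxE !eqxx rmorph1 mul1r mulr1; apply/eqP; rewrite eq_le -oppr_ge0.
  rewrite Fpos ?andbT; last exact: munit_cone.
  by rewrite -mulN1r -FZ scaleN1r; apply: FposD; apply: Cproj_diag.
have psiB := linear_funB (cpmap_linear cpm).
(* In odd columns [psi p] vanishes; in even ones [psi (e - p)] vanishes, so [psi p] agrees with
   [psi e]. *)
have pE : psi p = psi e *m E.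
  apply/matrixP => B A; have /colP/(_ B) := diag0 A.
  rewrite -colE mxE [X in _ = X -> _]mxE => h0; rewrite [RHS]mxE.
  have -> : \sum_k psi e B k * E k A = psi e B A * (~~ odd (mxtens_unindex A).2)%:R.
    rewrite (bigD1 A) //= big1 ?addr0 => [|k kA].
      by rewrite [E _ _]mxE eqxx.
    by rewrite [E _ _]mxE (negPf kA) mulr0.
  move: h0; case: odd; first by rewrite mulr0.
  rewrite mulr1 psiB !mxE => h0.
  by rewrite (subr0_eq h0).
have Eh : adjmx E = E.
  apply/matrixP => A B; rewrite !mxE rmorph_nat eq_sym.
  by case: eqP => // ->.
have EE : E *m E = E.
  apply/matrixP => A B; rewrite mxE (bigD1 A) //= big1 ?addr0 => [|k kA].
    by rewrite !mxE eqxx -natrM; case: odd; rewrite /= ?andbF ?mul0n ?mul1n.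
  by rewrite mxE eq_sym (negPf kA) mul0r.
have ps := cone_herm1 hV Cp.
have Ep : psi p = E *m psi e.
  rewrite -{1}ps (cpmap_star cpm) pE adjmxM Eh.
  by rewrite (cpmap_unit_herm hV cpm).
have [r [phi [Dm [uphi sphi idphi]]]] := cpmap_normalize hV cpm.
exists r, phi; split=> //; first exact: idphi EE Ep pE.
(* With these indicator vectors the matrix in [choi_form] is [ampl 2 x]. *)
pose h i : 'cV[R[i]]_(n * 2) := \col_A ((mxtens_unindex A).1 == i)%:R.
exists (fun i => Dm *m h i).
have -> : \sum_i \sum_j sesq (phi (x i j)) (Dm *m h i) (Dm *m h j) = F (ampl 2 x).
  transitivity (\sum_i \sum_j sesq (psi (x i j)) (h i) (h j)).
    by apply: eq_bigr => i _; apply: eq_bigr => j _; rewrite sphi.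
  rewrite form; congr F; apply/matrixP => A B; rewrite !mxE.
  under eq_bigr => i _ do under eq_bigr => j _ do rewrite !mxE rmorph_nat -scalerA.
  under eq_bigr => i _ do rewrite -scaler_sumr.
  rewrite (sum_delta _ (fun i => \sum_j ((mxtens_unindex B).1 == j)%:R *: x i j)).
  by rewrite (sum_delta _ (fun j => x _ j)).
rewrite lecE negb_and /= -ltNge; apply/orP; right; exact: fx.
Qed.

Lemma core_abstract_projection :
  (forall n (x : 'M[V]_n), D (ampl 2 x) -> C x) -> abstract_projection C e p.
Proof.
move=> core; have [Cp Cq] := hp.
have ps := cone_herm1 hV Cp.
pose A := {classic {k : nat & {phi : V -> 'M[R[i]]_k |
   ucp star C e phi /\ phi p *m phi p = phi p}}}.
pose k (a : A) := projT1 a; pose phi (a : A) := proj1_sig (projT2 a).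
have hphi a : ucp star C e (phi a) := (proj2_sig (projT2 a)).1.
have idem a : phi a p *m phi a p = phi a p := (proj2_sig (projT2 a)).2.
apply: (dsum_abstract_projection hV (k := k) hphi) => // n x hx.
have herm m (y : 'M[V]_m) : mxstar star y = y -> (forall a (g : 'I_m -> 'cV[R[i]]_(k a)),
       0 <= \sum_i \sum_j sesq (phi a (y i j)) (g i) (g j)) -> C y.
  move=> yh hy; apply: contrapT => nCy.
  have [r [ph [uph iph [g /negP]]]] := projection_ucp_separation core yh nCy.
  apply; pose a : A := existT _ r (exist _ ph (conj uph iph)).
  exact: (hy a g).
apply: (herm) => //.
(* For general [x] the form [q] is real by hypothesis, so the form of [c (x - mxstar star x)] is
   [c (q - conj q) = 0], and the hermitian case applies to it. *)
have q0 (c : R[i]) : Num.conj c = - c -> C (mxscale c (x - mxstar star x)).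
  move=> cc; apply: herm => [|a g].
    rewrite mxstarZ mxstarD mxstarN mxstarK cc.
    by apply/matrixP => i j; rewrite !mxE scaleNr -scalerN opprB.
  have lin := cpmap_linear (hphi a).
  set q := \sum_i \sum_j sesq (phi a (x i j)) (g i) (g j).
  have -> : \sum_i \sum_j sesq (phi a (mxscale c (x - mxstar star x) i j)) (g i) (g j) =
     c * (q - Num.conj q).
    have -> : Num.conj q = \sum_i \sum_j sesq (phi a (star (x j i))) (g i) (g j).
      rewrite /q rmorph_sum exchange_big /=; apply: eq_bigr => i _.
      by rewrite rmorph_sum; apply: eq_bigr => j _; rewrite /= -sesq_adj (cpmap_star (hphi a)).
    rewrite /q -sumrB mulr_sumr; apply: eq_bigr => i _.
    rewrite -sumrB mulr_sumr; apply: eq_bigr => j _.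
    rewrite !mxE (linear_funZ lin) (linear_funB lin) sesqZ; congr (_ * _).
    by rewrite /sesq mulmxBr mulmxBl mxE [X in _ + X]mxE.
  have -> : Num.conj q = q by apply/CrealP; apply: ger0_real; exact: hx.
  by rewrite subrr mulr0.
exact: (mxstar_fixed hV q0).
Qed.

End Separation.

(** * Several projections *)

Section NatIndexedMatrices.
Variables (R : realType) (V : lmodType R[i]).

(** Peeling changes the size [n * 2 ^ j] at every step. With entries given by functions of natural
    numbers, deleting the last bit of an index is division by [2], without casts. *)
Definition natmx d (F : nat -> nat -> V) : 'M[V]_d := \matrix_(i, j) F i j.

Definition nat_entries n (x : 'M[V]_n) (a b : nat) : V :=
  match insub a, insub b with Some i, Some j => x i j | _, _ => 0 end.

Lemma nat_entriesE n (x : 'M[V]_n) (i j : 'I_n) : nat_entries x i j = x i j.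
Proof. by rewrite /nat_entries !valK. Qed.

Lemma natmx_ext d (F G : nat -> nat -> V) :
  (forall a b, (a < d)%N -> (b < d)%N -> F a b = G a b) -> natmx d F = natmx d G.
Proof. by move=> FG; apply/matrixP => i j; rewrite !mxE FG. Qed.

(* [gate s q r] is [I (x) (q (+) r) (x) J_(2^s)]: the bit [s] of the index selects [q] or [r]. *)
Definition gate (s : nat) (q r : V) (a b : nat) : V :=
  if (a %/ 2 ^ s == b %/ 2 ^ s)%N then (if odd (a %/ 2 ^ s) then r else q) else 0.

Lemma gateS s q r a b : gate s.+1 q r a b = gate s q r (a %/ 2)%N (b %/ 2)%N.
Proof. by rewrite /gate expnS !divnMA. Qed.

Lemma gateD s q r q' r' a b : gate s (q + q') (r + r') a b = gate s q r a b + gate s q' r' a b.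
Proof. by rewrite /gate; case: eqP => _; rewrite ?addr0 //; case: odd. Qed.

Lemma gateZ s (c : R[i]) q r a b : gate s (c *: q) (c *: r) a b = c *: gate s q r a b.
Proof. by rewrite /gate; case: eqP => _; rewrite ?scaler0 //; case: odd. Qed.

Lemma eq_div_mod2 a b : (a == b) = (a %/ 2 == b %/ 2)%N && (odd a == odd b).
Proof.
apply/eqP/andP => [->//|[/eqP ab /eqP oab]].
by rewrite (divn_eq a 2) (divn_eq b 2) !modn2 ab oab.
Qed.

Lemma spread_gate N (k : 'I_N) q r (a b : 'I_(2 ^ N)) :
  spread k (dsum q r) a b = gate (N - k.+1) q r a b.
Proof.
rewrite /spread castmxE mxE [X in X *: _]mxE [X in _ *: X]mxE [X in _ *: (X *: _)]mxE.
rewrite scale1r dsumE -!(inj_eq val_inj) /= /gate.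
have split2 c : (c %% (2 * 2 ^ (N - k.+1)) %/ 2 ^ (N - k.+1) = (c %/ 2 ^ (N - k.+1)) %% 2)%N.
  by rewrite modn_divl.
rewrite !split2 !(mulnC 2) !divnMA !modn2.
rewrite [in RHS]eq_div_mod2.
case: eqP => _; last by rewrite scale0r.
by rewrite scale1r /=; do 2 case: odd.
Qed.

(** [I_n] fuses with the leading identity factor: equal quotients and remainders by [2 ^ k.+1] mean
    equal prefixes of the index. Hence one [gate] serves every [n]. *)
Lemma kron_spread_gate n N (k : 'I_N) q r (A B : 'I_(n * 2 ^ N)) :
  kronl (1%:M : 'M_n) (spread k (dsum q r)) A B = gate (N - k.+1) q r A B.
Proof.
rewrite mxE [X in X *: _]mxE spread_gate -!(inj_eq val_inj) /= /gate.
set s := (N - k.+1)%N.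
have Ns : (2 ^ N = 2 ^ k.+1 * 2 ^ s)%N by rewrite -expnD subnKC.
have modE c : ((c %% 2 ^ N) %/ 2 ^ s = (c %/ 2 ^ s) %% 2 ^ k.+1)%N by rewrite Ns modn_divl.
have divE c : (c %/ 2 ^ N = (c %/ 2 ^ s) %/ 2 ^ k.+1)%N by rewrite Ns mulnC divnMA.
rewrite !modE !divE; move: (A %/ 2 ^ s)%N (B %/ 2 ^ s)%N => a b.
have -> : odd (a %% 2 ^ k.+1)%N = odd a.
  by rewrite [in RHS](divn_eq a (2 ^ k.+1)) oddD oddM oddX /= andbF.
case: (eqVneq a b) => [->|ab]; first by rewrite !eqxx scale1r.
case: eqP => [e1|_]; last by rewrite scale0r.
case: eqP => [e2|_]; last by rewrite scaler0.
by case/eqP: ab; rewrite (divn_eq a (2 ^ k.+1)) (divn_eq b (2 ^ k.+1)) e1 e2.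
Qed.

End NatIndexedMatrices.

Section SeveralProjections.
Variables (R : realType) (V : lmodType R[i]) (star : V -> V).
Variables (C : forall n, set 'M[V]_n) (e : V) (hV : operator_system star C e).

Lemma cone_gate d s q r : C (q%:M : 'M[V]_1) -> C (r%:M : 'M[V]_1) ->
  C (natmx d (gate s q r)).
Proof.
move=> Cq Cr; have lt (A : 'I_d) : (A %/ 2 ^ s < d)%N by apply: leq_ltn_trans (leq_div _ _) _.
have := cone_block_diag hV (fun A : 'I_d => Ordinal (lt A))
  (fun A : 'I_d => if odd (A %/ 2 ^ s)%N then ord_max else ord0) (cone_dsum hV Cq Cr).
congr (C _); apply/matrixP => A B; rewrite [LHS]mxE [RHS]mxE dsumE -!(inj_eq val_inj) /= /gate.
case: eqP => [->|_]; last by rewrite scale0r.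
by rewrite eqxx scale1r; case: (odd (B %/ 2 ^ s)%N).
Qed.

Section Peel.
Variables (p : V) (hp : positive_contraction C e p).
Hypothesis core : forall n (x : 'M[V]_n), Cproj star C e p (ampl 2 x) -> C x.

(* With [d = delta / eps] and [r ^ 2 = d], the matrix
   [e (x) J_2 - P + d P + (1 / d) Q] dominates [p (x) v v^* + (e - p) (x) v' v'^*],
   where [v = (r, 1/r)] and [v' = (1/r, r)]. *)
Lemma peel m (z : 'M[V]_m) (eps t : R) : 0 < eps -> 0 < t ->
  C (ampl 2 z + mxscale eps%:C (kronl (1%:M : 'M_m) (dsum p (e - p)))
     + mxscale t%:C (kronl (1%:M : 'M_m) (dsum (e - p) p))) ->
  C (z + mxscale eps%:C e%:M).
Proof.
move=> e0 t0 Cz; have [Cp Cq] := hp; apply: core.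
have main (delta : R) : 0 < delta -> C (ampl 2 (z + mxscale eps%:C e%:M) +
     mxscale delta%:C (kronl (1%:M : 'M_m) (dsum p (e - p)))
     + mxscale (t + eps * (eps / delta))%:C (kronl (1%:M : 'M_m) (dsum (e - p) p))).
  move=> d0; have [r r0 rE] : exists2 r : R, r != 0 & r * r = delta / eps.
    by exists (Num.sqrt (delta / eps)); rewrite -?expr2 ?sqr_sqrtr ?gt_eqF ?sqrtr_gt0 ?ltW ?divr_gt0.
  have dE : delta = eps * (r * r) by rewrite rE mulrC divfK ?gt_eqF.
  have dV : eps / delta = r^-1 * r^-1 by rewrite dE; field; rewrite r0 gt_eqF.
  pose v (s : 'I_2) : R[i] := (if odd s then r^-1 else r)%:C.
  pose v' (s : 'I_2) : R[i] := (if odd s then r else r^-1)%:C.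
  (* The third summand [Q] supplies the unit minus [P] on the diagonal; off the diagonal the rank
     one terms add up to [p + (e - p) = e], as [r] times [r^-1] is [1]. *)
  have CT := cone_add hV (cone_add hV (cone_pull hV v (fun=> ord0) Cp)
    (cone_pull hV v' (fun=> ord0) Cq)) (cone_dsum hV Cq Cp).
  set T := (_ + _) in CT.
  have TE s u : eps%:C *: T s u = eps%:C *: e - eps%:C *: dsum p (e - p) s u
     + delta%:C *: dsum p (e - p) s u + (eps * (eps / delta))%:C *: dsum (e - p) p s u.
    have -> : T s u = (v s * Num.conj (v u)) *: p + (v' s * Num.conj (v' u)) *: (e - p)
        + dsum (e - p) p s u.
      rewrite /T mxE [X in X + _]mxE [pull v _ _ _ _]mxE [pull v' _ _ _ _]mxE.
      by rewrite ![(_%:M : 'M[V]_1) _ _]mxE !mulr1n.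
    rewrite /v /v' !conj_real -!rmorphM /= !dsumE dV dE.
    have [->|su] := eqVneq s u.
      move: (e - p) (subrK p e) => q' eE; rewrite -eE.
      case: (odd u); rewrite !scalerDr !scalerA -!rmorphM /=.
        by rewrite [eps%:C *: q' + _]addrC addrK -[RHS]addrA [RHS]addrC; congr (_ + _); rewrite addrC.
      by rewrite addrK -[RHS]addrA [RHS]addrC.
    have -> : odd s = ~~ odd u.
      by case: s u su => [[|[|//]] ?] [[|[|//]] ?].
    by case: (odd u); rewrite /= ?mulVf ?divff // rmorph1 !scaler0 subr0 !addr0 !scale1r addrC subrK.
  have := cone_add hV Cz (cone_scale hV (ltW e0) (cone_kron hV m CT)).
  congr (C _); apply/matrixP => A B.
  case: (mxtens_indexP A) => i s; case: (mxtens_indexP B) => j u.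
  have hP := kron1E (dsum p (e - p)) i j s u; have hQ := kron1E (dsum (e - p) p) i j s u.
  have hT := kron1E T i j s u.
  move: (kronl _ _) hP => KP hP; move: (kronl _ _) hQ => KQ hQ.
  move: (kronl _ _) hT => KT hT.
  rewrite !mxE hP hQ hT !mxtens_indexK /=.
  have [_|_] := eqVneq i j; last by rewrite !scale0r mulr0n !scaler0 !addr0.
  rewrite !scale1r mulr1n TE (rmorphD _ t) scalerDl /=.
  move: (_ *: e) (_ *: dsum _ _ _ _) (_ *: dsum _ _ _ _) (_ *: dsum _ _ _ _)
   (_ *: dsum _ _ _ _) (z i j) => x a b y w c.
  rewrite -!addrA; congr (c + _); rewrite [in LHS](addrCA x) (addrCA y) addNKr.
  by rewrite [LHS]addrCA; congr (x + _); rewrite addrCA.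
have hK q r : C (q%:M : 'M[V]_1) -> C (r%:M : 'M[V]_1) -> forall a : R, 0 <= a ->
    C (mxscale a%:C (kronl (1%:M : 'M_m) (dsum q r))).
  by move=> Cq' Cr a a0; apply: (cone_scale hV) => //; apply: (cone_kron_dsum hV).
split; last by move=> d d0; exists (t + eps * (eps / d));
  [by rewrite addr_gt0 // mulr_gt0 // divr_gt0|exact: main].
(* The ampliation is hermitian because one positive perturbation of it is, with hermitian added
   terms. *)
have := mo_herm (os_ordering hV) (main 1 ltr01); rewrite !(mxstarD hV).
rewrite (mo_herm (os_ordering hV) (hK _ _ Cp Cq _ ler01)).
rewrite (mo_herm (os_ordering hV) (hK _ _ Cq Cp (t + eps * (eps / 1)) _)).
  by move=> /addIr/addIr.
by rewrite divr1 addr_ge0 ?mulr_ge0 // ltW.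
Qed.

Lemma peel_natmx m (zf : nat -> nat -> V) (eps t : R) : 0 < eps -> 0 < t ->
  C (natmx (m * 2) (fun a b => zf (a %/ 2)%N (b %/ 2)%N +
     gate 0 (eps%:C *: p + t%:C *: (e - p)) (eps%:C *: (e - p) + t%:C *: p) a b)) ->
  C (natmx m (fun a b => zf a b + (if a == b then eps%:C *: e else 0))).
Proof.
move=> e0 t0 Cz.
suff : C (natmx m zf + mxscale eps%:C e%:M).
  congr (C _); apply/matrixP => i j; rewrite !mxE -(inj_eq val_inj) /=.
  by case: eqP; rewrite ?mulr1n // mulr0n scaler0.
apply: (peel e0 t0); move: Cz; congr (C _); apply/matrixP => A B.
case: (mxtens_indexP A) => i s; case: (mxtens_indexP B) => j u.
have hP := kron1E (dsum p (e - p)) i j s u; have hQ := kron1E (dsum (e - p) p) i j s u.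
move: (kronl _ _) hP => KP hP; move: (kronl _ _) hQ => KQ hQ.
rewrite !mxE hP hQ !mxtens_indexK /= !divnMDl // !divn_small ?ltn_ord // !addn0 -addrA.
congr (_ + _); rewrite gateD !gateZ /gate expn0 !divn1 !dsumE.
have -> : (i * 2 + s == j * 2 + u)%N = (i == j) && (s == u).
  rewrite eq_div_mod2 !divnMDl // !divn_small ?ltn_ord // !addn0 !oddD !oddM !andbF /=.
  by congr (_ && _); case: s u {hP hQ} => [[|[|//]] ?] [[|[|//]] ?].
rewrite oddD oddM andbF /=; case: (i == j); last by rewrite !scale0r.
by rewrite !scale1r /=; case: (s == u); case: odd.
Qed.

End Peel.

Variables (N : nat) (p : 'I_N -> V).
Hypothesis hp : forall i, positive_contraction C e (p i).

Lemma cone_Pmx k : C (Pmx e p k).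
Proof.
have [Cp Cq] := hp k; have := cone_gate (2 ^ N) (N - k.+1) Cp Cq.
by congr (C _); apply/matrixP => i j; rewrite mxE spread_gate.
Qed.

Lemma cone_Qmx k : C (Qmx e p k).
Proof.
have [Cp Cq] := hp k; have := cone_gate (2 ^ N) (N - k.+1) Cq Cp.
by congr (C _); apply/matrixP => i j; rewrite mxE spread_gate.
Qed.

Lemma Cprojs_embedding :
  complete_order_embedding C (cone_quot_cone (Cprojs star C e p))
    (cone_quot_map (Cprojs star C e p)) <->
  forall n (x : 'M[V]_n), Cprojs star C e p (ampl (2 ^ N) x) -> C x.
Proof. exact: (cone_quot_embedding hV cone_Pmx cone_Qmx). Qed.

Lemma ksum_gate n (a : 'I_N -> R) (q r : 'I_N -> V) (A B : 'I_(n * 2 ^ N)) :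
  ksum n a (fun k : 'I_N => spread k (dsum (q k) (r k))) A B =
  \sum_k (a k)%:C *: gate (N - k.+1) (q k) (r k) A B.
Proof. by rewrite /ksum summxE; apply: eq_bigr => k _; rewrite mxE kron_spread_gate. Qed.

(* Peeling the projections off one at a time, last one first: the term
   [eps (I (x) e)] produced by one step is [eps (P + Q)] for the next one. *)
Lemma Cprojs_core : (0 < N)%N ->
  (forall i n (x : 'M[V]_n), Cproj star C e (p i) (ampl 2 x) -> C x) ->
  forall n (x : 'M[V]_n), Cprojs star C e p (ampl (2 ^ N) x) -> C x.
Proof.
move=> N0 core n x [_ hx]; apply: (os_arch hV) => d d0.
have N0' : 0 < (N%:R : R) by rewrite ltr0n.
(* Each of the [N] steps leaves eps times the unit, in total [d]. *)
pose eps := d / N%:R; have e0 : 0 < eps by rewrite divr_gt0.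
have [t [t0 Ct _]] := hx (fun=> eps) (fun=> e0).
pose q k := eps%:C *: p k + (t k)%:C *: (e - p k).
pose r k := eps%:C *: (e - p k) + (t k)%:C *: p k.
(* The state when the first [j] projections remain: projection [k] sits at bit [j - k.+1], and [c]
   is the accumulated multiple of the unit. *)
pose M j (c : R) := natmx (n * 2 ^ j) (fun a b =>
   nat_entries x (a %/ 2 ^ j)%N (b %/ 2 ^ j)%N
   + \sum_(k < N | (k < j)%N) gate (j - k.+1) (q k) (r k) a b
   + (if a == b then c%:C *: e else 0)).
have step j c : (j < N)%N -> 0 <= c -> C (M j.+1 c) -> C (M j (c + eps)).
  move=> jN c0; pose k0 := Ordinal jN.
  pose zf a b := nat_entries x (a %/ 2 ^ j)%N (b %/ 2 ^ j)%N
    + \sum_(k < N | (k < j)%N) gate (j - k.+1) (q k) (r k) a b.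
  (* Writing [c e = c p + c (e - p)] raises both coefficients of the next projection, to [c + eps]
     and [t + c]. *)
  have := peel_natmx (hp k0) (core k0) (m := n * 2 ^ j) (zf := zf) (eps := c + eps) (t := t k0 + c).
  have ce0 : 0 < c + eps by rewrite ltr_wpDl.
  have tc0 : 0 < t k0 + c by rewrite ltr_wpDr.
  move=> /(_ ce0 tc0) peelj Cj; apply: peelj.
  have dim : (n * 2 ^ j.+1 = n * 2 ^ j * 2)%N by rewrite expnSr mulnA.
  move: Cj; rewrite /M dim; congr (C _); apply: natmx_ext => a b _ _.
  rewrite /zf -!divnMA -expnS -!addrA; congr (_ + _).
  rewrite (bigD1 k0) ?ltnSn //= subSS subnn.
  have -> : \sum_(i < N | (i < j.+1)%N && (i != k0)) gate (j.+1 - i.+1) (q i) (r i) a b =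
      \sum_(k < N | (k < j)%N) gate (j - k.+1) (q k) (r k) (a %/ 2)%N (b %/ 2)%N.
    apply: eq_big => [k|k /andP[kj1 kk0]].
      by rewrite -(inj_eq val_inj) /= ltnS [RHS]ltn_neqAle andbC.
    rewrite -gateS; congr gate; rewrite -subSn // ltn_neqAle -ltnS kj1 andbT.
    by rewrite -(inj_eq val_inj) in kk0.
  rewrite -addrA addrCA; congr (_ + _).
  have -> : (if a == b then c%:C *: e else 0) = gate 0 (c%:C *: e) (c%:C *: e) a b.
    by rewrite /gate expn0 !divn1; case: odd.
  rewrite -gateD /q /r !rmorphD !scalerDl /=.
  have -> : c%:C *: e = c%:C *: p k0 + c%:C *: (e - p k0) by rewrite -scalerDr addrC subrK.
  congr gate; first by rewrite addrACA [_ + c%:C *: p k0]addrC.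
  by rewrite [c%:C *: p k0 + _]addrC addrACA [_ + c%:C *: (e - _)]addrC.
have CMN : C (M N 0).
  move: Ct; rewrite /perturbed_mem; congr (C _); apply/matrixP => A B.
  have := ksum_gate (fun=> eps) p (fun k => e - p k) A B.
  have := ksum_gate t (fun k => e - p k) p A B.
  rewrite /ksum => h1 h2; rewrite 2![in LHS]mxE [X in X + _ + _]mxE.
  rewrite [X in _ + X]h1 [X in _ + X + _]h2 [RHS]mxE.
  rewrite -nat_entriesE scale0r if_same addr0 -addrA; congr (_ + _).
  rewrite -big_split; apply: eq_big => [k|k _]; first by rewrite ltn_ord.
  by rewrite /q /r gateD !gateZ.
have down i : (i <= N)%N -> C (M (N - i)%N (i%:R * eps)).
  elim: i => [|i ih] iN; first by rewrite subn0 mul0r.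
  have := ih (ltnW iN); rewrite -(subnSK iN) -natr1 mulrDl mul1r; apply: step.
    by rewrite ltn_subrL.
  by rewrite mulr_ge0 // ltW.
have := down N (leqnn _); rewrite subnn /M expn0 muln1 /eps mulrC divfK ?gt_eqF //.
congr (C _); apply/matrixP => i j; rewrite !mxE !divn1 nat_entriesE big1 => [|k]; last by [].
by rewrite addr0 addrC -(inj_eq val_inj) /=; case: eqP; rewrite ?mulr1n // mulr0n scaler0.
Qed.

(* The bits of the index other than the one of [p i] contribute an all-ones block,
   which is dominated by a multiple of the identity. *)
Lemma core_Cprojs :
  (forall n (x : 'M[V]_n), Cprojs star C e p (ampl (2 ^ N) x) -> C x) ->
  forall i n (x : 'M[V]_n), Cproj star C e (p i) (ampl 2 x) -> C x.
Proof.
(* Size [0] is split off since eps is divided below by [sqnorm w], which is [n.+1 * 2 ^ N]. *)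
move=> core i [|n] x [xh hx].
  by rewrite (_ : x = 0); [exact: mo0 (os_ordering hV) _|apply/matrixP => -[]].
apply: core; have [Cp Cq] := hp i; pose d := (n.+1 * 2 ^ N)%N.
pose w (_ : 'I_d) : R[i] := 1; pose s := (N - i.+1)%N.
have w1 : 0 < sqnorm w.
  rewrite /sqnorm (eq_bigr (fun=> 1)) => [|k _]; last by rewrite /sqmod /= expr0n expr1n addr0.
  by rewrite sumr_const card_ord pmulrn ltr0n muln_gt0 /= expn_gt0.
have lt (A : 'I_d) : (A %/ 2 ^ s < d)%N by apply: leq_ltn_trans (leq_div _ _) _.
(* [nu] labels the blocks of the gate at bit [s]; [u] keeps of an index only its row in [x] and the
   bit [s]. *)
pose nu (A : 'I_d) := Ordinal (lt A).
pose u (A : 'I_d) : 'I_(n.+1 * 2) := mxtens_index ((mxtens_unindex A).1,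
   if odd (A %/ 2 ^ s)%N then ord_max else ord0).
have one eps : 0 < eps -> exists2 t : R, 0 < t &
    pert C (Pmx e p) (Qmx e p) (ampl (2 ^ N) x)
     (fun k => if k == i then eps else 0) (fun k => if k == i then t else 0).
  move=> e0; have [t t0 Ct] := hx _ (divr_gt0 e0 w1); exists (sqnorm w * t).
    exact: mulr_gt0.
  have lag q r a (Cq' : C (q%:M : 'M[V]_1)) (Cr : C (r%:M : 'M[V]_1)) (a0 : 0 <= a) :=
    cone_scale hV a0 (cone_lagrange hV nu u w (cone_kron_dsum hV n.+1 Cq' Cr)).
  (* Compression by the all-ones [w] loses the factor [nu A == nu B]; the Lagrange terms restore it
     at the price of the factor [sqnorm w], whence the tolerance [eps / sqnorm w]. *)
  have := cone_add hV (cone_add hV (cone_pull hV w u Ct)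
     (lag _ _ _ Cp Cq (ltW (divr_gt0 e0 w1)))) (lag _ _ _ Cq Cp (ltW t0)).
  congr (C _); apply/matrixP => A B.
  have hK q r : (nu A == nu B)%:R *: kronl (1%:M : 'M_n.+1) (dsum q r) (u A) (u B) =
      gate s q r A B :> V.
    rewrite kron1E dsumE -!(inj_eq val_inj) /= /gate.
    case: eqP => [AB|_]; last by rewrite scale0r.
    have Ns : (2 ^ N = 2 ^ s * 2 ^ i.+1)%N by rewrite -expnD subnK.
    have divE c : (c %/ 2 ^ N = c %/ 2 ^ s %/ 2 ^ i.+1)%N by rewrite Ns divnMA.
    by rewrite !divE AB !eqxx !scale1r; case: (odd (B %/ 2 ^ s)%N).
  have ks a (q r : 'I_N -> V) : ksum n.+1 (fun k => if k == i then a else 0)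
      (fun k => spread k (dsum (q k) (r k))) A B = a%:C *: gate s (q i) (r i) A B.
    rewrite ksum_gate (bigD1 i) //= eqxx big1 ?addr0 // => k /negPf ->.
    by rewrite scale0r.
  have ksP := ks eps p (fun k => e - p k).
  have ksQ := ks (sqnorm w * t) (fun k => e - p k) p.
  have hP := hK (p i) (e - p i); have hQ := hK (e - p i) (p i).
  move: (ksum _ _ _) ksP => KsP ksP; move: (ksum _ _ _) ksQ => KsQ ksQ.
  move: (kronl _ _) hP => KP hP; move: (kronl _ _) hQ => KQ hQ.
  rewrite !mxE ksP ksQ -hP -hQ /w /u !mxtens_indexK /=.
  move: (KP _ _) (KQ _ _) (x _ _) (nu A == nu B)%:R => kp kq xx b.
  rewrite rmorph1 mulr1 scale1r -!addrA; congr (xx + _).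
  have comb (a : R) (v : V) : a%:C *: v + a%:C *: ((b * (sqnorm w)%:C - 1) *: v) =
      (sqnorm w * a)%:C *: (b *: v).
    rewrite -scalerDr -[X in _ *: (X + _)]scale1r -scalerDl addrC subrK !scalerA.
    by rewrite rmorphM; congr (_ *: _); rewrite /=; ring.
  rewrite [t%:C *: kq + _]addrCA [LHS]addrA !comb mulrC divfK // gt_eqF //.
have /choice[tau tauP] : forall eps, exists t : R, 0 < eps -> 0 < t /\
    pert C (Pmx e p) (Qmx e p) (ampl (2 ^ N) x)
     (fun k => if k == i then eps else 0) (fun k => if k == i then t else 0).
  move=> eps; have [e0|_] := ltP 0 eps; last by exists 0.
  by have [t t0 h] := one _ e0; exists t.
have pm := @pert_mono _ _ _ _ _ hV _ _ _ _ cone_Pmx cone_Qmx.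
split.
  apply/matrixP => A B; rewrite !mxE.
  have /matrixP/(_ (mxtens_index ((mxtens_unindex A).1, ord0))
     (mxtens_index ((mxtens_unindex B).1, ord0))) := xh.
  by rewrite !mxE !mxtens_indexK.
move=> eps e0; have [t0 xt] := tauP _ (e0 i).
(* The terms of the other projections are positive extras: their coefficient is [1], and [2] when
   the last clause asks for an increase. *)
exists (fun k => if k == i then tau (eps i) else 1); split.
- by move=> k; case: ifP.
- by apply: (pm) xt => k; case: eqP => [ki|_]; rewrite ?ki // ltW.
move=> j eps' /andP[e'0 e'lt]; have [ji|ji] := eqVneq j i.
  have [t'0 xt'] := tauP _ e'0; exists (Num.max (tau eps') (tau (eps i) + 1)).
    by rewrite lt_max ltrDl ltr01 orbT.
  apply: (pm) xt' => k /=; rewrite ji; case: eqP => [//|_].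
  - by rewrite ltW.
  - by rewrite le_max lexx.
  - by [].
have xt2 : pert C (Pmx e p) (Qmx e p) (ampl (2 ^ N) x) [eta eps with j |-> eps']
   [eta fun k => if k == i then tau (eps i) else 1 with j |-> 2].
  apply: (pm) xt => k /=; case: (eqVneq k i) => [->|ki].
  - by rewrite eq_sym (negPf ji).
  - by case: ifP => _; rewrite ltW.
  - by rewrite eq_sym (negPf ji).
  - by case: ifP.
by exists 2; rewrite // ltr1n.
Qed.

End SeveralProjections.

Theorem theorem4p9 (R : realType) (V : lmodType R[i]) (star : V -> V)
    (C : forall n, set 'M[V]_n) (e : V) (hV : operator_system star C e)
    (N : nat) (hN : (0 < N)%N) (p : 'I_N -> V)
    (hp : forall i, positive_contraction C e (p i)) :
  let st1 := forall i, abstract_projection C e (p i) in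
  let st2 := forall i,
    complete_order_embedding C
      (cone_quot_cone (Cproj star C e (p i)))
      (cone_quot_map (Cproj star C e (p i))) in
  let st3 :=
    complete_order_embedding C
      (cone_quot_cone (Cprojs star C e p))
      (cone_quot_map (Cprojs star C e p)) in
  (st1 <-> st2) /\ (st2 <-> st3).
Proof.
move=> st1 st2 st3; split; split.
- move=> h i; apply/(Cproj_embedding hV (hp i)).
  exact: abstract_projection_core (h i).
- move=> h i; apply: (core_abstract_projection hV (hp i)).
  exact/(Cproj_embedding hV (hp i)).
- move=> h; apply/(Cprojs_embedding hV hp); apply: (Cprojs_core hV hp hN) => i.
  exact/(Cproj_embedding hV (hp i)).
- move=> /(Cprojs_embedding hV hp) core i; apply/(Cproj_embedding hV (hp i)).
  exact: (core_Cprojs hV hp core).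
Qed.
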